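(* Suppose that $\nabla Q_\tau(\cdot)$ exists for almost all $\tau\in(0,1)$ and $\mathbf X$ (that is, for Lebesgue-almost every $\tau\in(0,1)$, the gradient $\nabla Q_\tau(\mathbf X)$ exists almost surely). Then the column space of the composite outer-product-of-gradients matrix $\Sigma=\int_0^1 E\{\nabla Q_\tau(\mathbf X)[\nabla Q_\tau(\mathbf X)]^\top\}\,d\tau$ equals the central subspace: $$\mathcal S(\Sigma)=\mathcal S(\mathbf B_0).$$
   Context: $Y$ is a scalar random variable and $\mathbf X$ a $p\times 1$ random vector; $F(\cdot|\mathbf X)$ is the conditional distribution function of $Y$ given $\mathbf X$. For a matrix $M$, $\mathcal S(M)$ is the space spanned by its columns. For a $p\times r$ matrix $\mathbf B$ ($r\le p$) with orthonormal columns, $\mathcal S(\mathbf B)$ is a dimension reduction subspace (DRS) if $F(\cdot|\mathbf X)=F(\cdot|\mathbf B^\top\mathbf X)$ almost surely, where $F(\cdot|\mathbf B^\top\mathbf X)$ is the conditional distribution function of $Y$ given $\mathbf B^\top\mathbf X$. The central subspace (CS) is $\mathcal S_0=\bigcap\{\mathcal S(\mathbf B):\mathcal S(\mathbf B)\text{ is a DRS}\}$, and it is assumed to exist, i.e. $\mathcal S_0$ is itself a DRS. Let $q=\dim\mathcal S_0$ and let $\mathbf B_0$ be a $p\times q$ matrix with orthonormal columns and $\mathcal S(\mathbf B_0)=\mathcal S_0$; thus $F(Y|\mathbf X)=F(Y|\mathbf B_0^\top\mathbf X)$ almost surely. For $0<\tau<1$, $Q_\tau(\mathbf x)=\min\{y:F(y|\mathbf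 x)\ge\tau\}$ is the $\tau$-th conditional quantile of $Y$ given $\mathbf X=\mathbf x$, and $\nabla Q_\tau(\mathbf x)=(\partial Q_\tau(\mathbf x)/\partial x_1,\ldots,\partial Q_\tau(\mathbf x)/\partial x_p)^\top$. The matrix $\Sigma$ is taken to be well defined (finite). Smoothness classes: for $s=l+\gamma$ with $l\ge0$ an integer and $0<\gamma\le1$, a function $m$ on $E\subset\mathbb R^d$ belongs to $H_s(E)$ if it is differentiable up to order $l$ and there is $C>0$ with $|D^{\mathbf u}m(\mathbf x_1)-D^{\mathbf u}m(\mathbf x_2)|\le C|\mathbf x_1-\mathbf x_2|^\gamma$ for all $\mathbf x_1,\mathbf x_2\in E$ and all multi-indices $\mathbf u$ of order $l$ ($|\cdot|$ is the supremum norm). Standing assumptions: $\mathbf X$ has a probability density function $f_{\mathbf X}$ whose support $\mathcal D=\{f_{\mathbf X}>0\}\subset\mathbb R^p$ is bounded, open and convex, and $f_{\mathbf X}\in H_{s_1}(\mathcal D)$ for some $s_1>0$; $Q_\tau\in H_{s_2}(\mathcal D)$ for some $s_2>0$ uniformly in $\tau\in(0,1)$; for all $\tau\in(0,1)$, $Q_\tau$ has partial derivatives of order up to $k$ on $\mathcal D$ for some positive integer $k$; there exist $\delta^*,b_1,b_2,s_3>0$ such that the conditional density $f_{Y|\mathbf X}(y|\mathbf x)$ of $Y$ given $\mathbf X$ has order of smoothness $s_3$ (as a function of $(y,\mathbf x)$, $y\in\mathbb R$, $\mathbf x\in\mathcal D$) and is uniformly bounded away from zero for $y\in(Q_\tau(\mathbf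 x)-b_1,Q_\tau(\mathbf x)+b_2)$, over all $\tau\in[\delta^*,1-\delta^*]$ and $\mathbf x\in\mathcal D$. *)

(* Defs.v *)
From HB Require Import structures.
From mathcomp Require Import all_boot all_order all_algebra.
From mathcomp Require Import all_classical all_reals all_analysis.

Set Implicit Arguments.
Unset Strict Implicit.
Unset Printing Implicit Defensive.

Import Order.TTheory GRing.Theory Num.Theory.
Import numFieldNormedType.Exports.

Local Open Scope classical_set_scope.
Local Open Scope ring_scope.

Definition measure_matrix_display : measure_display -> measure_display.
Proof. exact. Qed.

(* As for tuples in the library, matrices carry the sigma-algebra generated by
   their entries; on real matrices this is the Borel sigma-algebra. *)
Section measurable_matrix.
Context {d} {T : measurableType d}.
Variables m n : nat.

Definition matrix_cylinders : set (set 'M[T]_(m, n)) :=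
  [set A | exists i j (B : set T), measurable B /\
     A = (fun M : 'M[T]_(m, n) => M i j) @^-1` B].

Let mx0 : <<s matrix_cylinders >> set0.
Proof. exact: sigma_algebra0. Qed.

Let mxC A : <<s matrix_cylinders >> A -> <<s matrix_cylinders >> (~` A).
Proof. exact: sigma_algebraC. Qed.

Let mx_bigcup (F : _^nat) : (forall i, <<s matrix_cylinders >> (F i)) ->
  <<s matrix_cylinders >> (\bigcup_i (F i)).
Proof. exact: sigma_algebra_bigcup. Qed.

HB.instance Definition _ := @isMeasurable.Build (measure_matrix_display d)
  'M[T]_(m, n) <<s matrix_cylinders >> mx0 mxC mx_bigcup.

End measurable_matrix.


Section lebesgue_vector_measure.
Context {R : realType}.

Lemma measurable_matrix_entry m n (i : 'I_m) (j : 'I_n) :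
  measurable_fun setT (fun M : 'M[R]_(m, n) => M i j).
Proof.
move=> _ B mB; rewrite setTI; apply: sub_sigma_algebra.
by exists i, j, B.
Qed.

Lemma measurable_fun_matrix d (T : measurableType d) m n
    (f : T -> 'M[R]_(m, n)) :
  (forall i j, measurable_fun setT (fun t => f t i j)) -> measurable_fun setT f.
Proof.
move=> mf; apply: (@measurability _ _ _ _ _ _ (@matrix_cylinders _ R m n)) => //.
move=> _ [_ [i [j [B [mB ->]]]] <-].
rewrite setTI -comp_preimage -[X in measurable X]setTI; exact: mf.
Qed.

Variable n : nat.
Implicit Type mu : {sigma_finite_measure set 'cV[R]_n -> \bar R}.

Definition cons_cV (tx : measurableTypeR R * 'cV[R]_n) : 'cV[R]_n.+1 :=
  col_mx (tx.1)%:M tx.2.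

Definition uncons_cV (z : 'cV[R]_n.+1) : measurableTypeR R * 'cV[R]_n :=
  (z ord0 ord0, dsubmx (z : 'cV[R]_(1 + n))).

Lemma cons_cVK : cancel cons_cV uncons_cV.
Proof.
move=> [t x]; rewrite /uncons_cV /cons_cV /= col_mxKd; congr (_, _).
transitivity (col_mx (t%:M : 'M[R]_1) x (lshift n ord0) ord0).
  by congr (col_mx _ _ _ _); apply/val_inj.
by rewrite col_mxEu mxE eqxx.
Qed.

Lemma uncons_cVK : cancel uncons_cV cons_cV.
Proof.
move=> z; apply/matrixP => i j; rewrite ord1 /cons_cV /uncons_cV /=.
case: (split_ordP (i : 'I_(1 + n))) => k ->.
  by rewrite (@col_mxEu _ 1 n 1) !ord1 mxE eqxx; congr (z _ _); apply/val_inj.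
by rewrite (@col_mxEd _ 1 n 1) mxE.
Qed.

Lemma measurable_cons_cV : measurable_fun setT cons_cV.
Proof.
apply: measurable_fun_matrix => i j; rewrite ord1.
case: (split_ordP (i : 'I_(1 + n))) => k ->.
  rewrite (_ : (fun _ => _) = fst); first exact: measurable_fst.
  by apply/funext => -[t x] /=; rewrite /cons_cV (@col_mxEu _ 1 n 1) !ord1 mxE eqxx.
rewrite (_ : (fun _ => _) = (fun x : 'cV[R]_n => x k ord0) \o snd).
  by apply: measurableT_comp; [exact: measurable_matrix_entry|exact: measurable_snd].
by apply/funext => -[t x] /=; rewrite /cons_cV (@col_mxEd _ 1 n 1).
Qed.

Lemma measurable_uncons_cV : measurable_fun setT uncons_cV.
Proof.
apply/measurable_fun_pairP; split => /=.
  exact: measurable_matrix_entry.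
apply: measurable_fun_matrix => i j; rewrite ord1.
rewrite (_ : (fun _ => _) = (fun z : 'cV[R]_n.+1 => z (rshift 1 i) ord0)).
  exact: measurable_matrix_entry.
by apply/funext => z /=; rewrite mxE.
Qed.

Definition lebesgue_cons mu : set 'cV[R]_n.+1 -> \bar R :=
  pushforward (lebesgue_measure \x mu)%E cons_cV.

Let lebesgue_cons0 mu : lebesgue_cons mu set0 = 0%E.
Proof. by rewrite /lebesgue_cons /pushforward preimage_set0 measure0. Qed.

Let lebesgue_cons_ge0 mu A : (0 <= lebesgue_cons mu A)%E.
Proof. by rewrite /lebesgue_cons /pushforward measure_ge0. Qed.

Let measurable_cons_preimage (A : set 'cV[R]_n.+1) :
  measurable A -> measurable (cons_cV @^-1` A).
Proof.
by move=> mA; rewrite -[X in measurable X]setTI; exact: measurable_cons_cV.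
Qed.

Let lebesgue_cons_sigma_additive mu : semi_sigma_additive (lebesgue_cons mu).
Proof.
move=> F mF tF mUF; rewrite /lebesgue_cons /pushforward preimage_bigcup.
apply: measure_semi_sigma_additive.
- by move=> k; exact: measurable_cons_preimage.
- apply/trivIsetP => /= i j _ _ ij; rewrite -preimage_setI.
  by move/trivIsetP : tF => /(_ _ _ _ _ ij) ->//; rewrite preimage_set0.
- by rewrite -preimage_bigcup; exact: measurable_cons_preimage.
Qed.

HB.instance Definition _ mu := isMeasure.Build _ _ _ (lebesgue_cons mu)
  (lebesgue_cons0 mu) (lebesgue_cons_ge0 mu)
  (@lebesgue_cons_sigma_additive mu).

Let lebesgue_cons_sigma_finite mu : sigma_finite setT (lebesgue_cons mu).
Proof.
have /sigma_finiteP[F [FT ndF Foo]] := sigma_finiteT (@lebesgue_measure R).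
have /sigma_finiteP[G [GT ndG Goo]] := sigma_finiteT mu.
exists (fun k => uncons_cV @^-1` (F k `*` G k)).
  apply/esym; rewrite -subTset => z _.
  have [i _ Fi] : (\bigcup_k F k) (uncons_cV z).1 by rewrite -FT.
  have [j _ Gj] : (\bigcup_k G k) (uncons_cV z).2 by rewrite -GT.
  exists (maxn i j) => //; split.
    by move: Fi; apply/subsetPset/ndF/leq_maxl.
  by move: Gj; apply/subsetPset/ndG/leq_maxr.
move=> k; have [mF Fk] := Foo k; have [mG Gk] := Goo k; split.
  rewrite -[X in measurable X]setTI.
  by apply: measurable_uncons_cV => //; exact: measurableX.
rewrite /lebesgue_cons /pushforward -comp_preimage.
rewrite (_ : _ \o _ = id); last by apply/funext => z /=; rewrite cons_cVK.
by rewrite preimage_id product_measure1E// lte_mul_pinfty// ge0_fin_numE.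
Qed.

HB.instance Definition _ mu := Measure_isSigmaFinite.Build _ _ _
  (lebesgue_cons mu) (lebesgue_cons_sigma_finite mu).

End lebesgue_vector_measure.

Fixpoint lebesgue_cV (R : realType) (n : nat) :
    {sigma_finite_measure set 'cV[R]_n -> \bar R} :=
  match n with
  | 0 => \d_ (0 : 'cV[R]_0)
  | n'.+1 => lebesgue_cons (lebesgue_cV R n')
  end.

Lemma lebesgue_cV_box (R : realType) n (A : 'I_n -> set R) :
  (forall i, measurable (A i)) ->
  lebesgue_cV R n [set x | forall i, A i (x i 0)] =
  (\prod_(i < n) lebesgue_measure (A i))%E.
Proof.
elim: n => [|n IH] in A * => mA /=.
  rewrite big_ord0 diracE mem_set//; by case.
have mB : measurable [set x : 'cV[R]_n | forall i, A (lift ord0 i) (x i 0)].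
  rewrite (_ : [set x | _] = \bigcap_(i in [set: 'I_n])
    ((fun x : 'cV[R]_n => x i 0) @^-1` A (lift ord0 i))).
    apply: fin_bigcap_measurable; first exact: finite_finset.
    move=> i _; rewrite -[X in measurable X]setTI.
    exact: measurable_matrix_entry.
  by apply/seteqP; split => [x Ax i _|x Ax i]; exact: Ax.
rewrite big_ord_recl /lebesgue_cons /pushforward.
rewrite (_ : _ @^-1` _ =
  A ord0 `*` [set x : 'cV[R]_n | forall i, A (lift ord0 i) (x i 0)]).
  rewrite product_measure1E//; last exact: mA.
  by congr (_ * _)%E; exact: (IH (fun i => A (lift ord0 i))).
have E0 (t : R) (x : 'cV[R]_n) : cons_cV (t, x) ord0 0 = t.
  by have /(congr1 fst) := cons_cVK (t, x).
have ES (t : R) (x : 'cV[R]_n) i : cons_cV (t, x) (lift ord0 i) 0 = x i 0.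
  have -> : lift ord0 i = rshift 1 i by apply/val_inj.
  by rewrite /cons_cV (@col_mxEd _ 1 n 1).
apply/funext => -[t x]; apply/propext; split => /=.
  by move=> H; split => [|i]; [rewrite -[t](E0 t x)|rewrite -(ES t)].
move=> [At Ax] i; case: (unliftP ord0 i) => [j|] ->; first by rewrite ES.
by rewrite E0.
Qed.

Section conditional_distribution.
Context {d} {T : measurableType d} {R : realType} (P : probability T R).
Variable Y : {RV P >-> R}.

Definition is_cond_cdf n (Z : T -> 'cV[R]_n)
    (F : 'cV[R]_n -> cumulativeBounded (0 : R) (1 : R)) : Prop :=
  (forall y, measurable_fun setT (fun z => F z y)) /\
  (forall A y, measurable A ->
     P (Z @^-1` A `&` Y @^-1` `]-oo, y]) =
     (\int[P]_(w in Z @^-1` A) (F (Z w) y)%:E)%E).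

Definition colspan p r (M : 'M[R]_(p, r)) : set 'cV[R]_p :=
  range (fun a : 'cV[R]_r => M *m a).

Variables (p : nat) (X : T -> 'cV[R]_p).
Variable F : 'cV[R]_p -> cumulativeBounded (0 : R) (1 : R).

(* F is a version of the conditional distribution function of Y given X; the
   notion depends neither on that version nor on the version G given B^T X.
   The value r = 0 is allowed: the zero space is then a DRS exactly when Y and
   X are independent. *)
Definition is_DRS (V : set 'cV[R]_p) : Prop :=
  exists r (B : 'M[R]_(p, r))
    (G : 'cV[R]_r -> cumulativeBounded (0 : R) (1 : R)),
    [/\ (r <= p)%N, B^T *m B = 1%:M, V = colspan B,
        is_cond_cdf (fun w => B^T *m X w) G &
        {ae P, forall w, forall y, F (X w) y = G (B^T *m X w) y}].

Definition central_subspace : set 'cV[R]_p := \bigcap_(V in is_DRS) V.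

End conditional_distribution.

Section quantile.
Context {R : realType}.

Definition quantile (F : R -> R) (tau : R) : R := inf [set y | tau <= F y].

(* The infimum is a minimum for every distribution function. *)
Lemma quantile_min (F : cumulativeBounded (0 : R) (1 : R)) (tau : R) :
  0 < tau < 1 ->
  tau <= F (quantile F tau) /\ forall y, tau <= F y -> quantile F tau <= y.
Proof.
move=> /andP[tau0 tau1].
have Fnd : nondecreasing F := cumulative_is_nondecreasing F.
have hinf : has_inf [set y | tau <= F y].
  split.
    have [y _ ?] := pinfty_ex_ge (num_real 0) (cvgr_ge _ (cumulativey F) _ tau1).
    by exists y.
  have [M [_ FM]] := cvgr_lt _ (cumulativeNy F) _ tau0.
  exists (M - 1) => y /= tauy; rewrite leNgt; apply/negP => yM.
  have := FM y (lt_trans yM _); rewrite ltrBlDr ltrDl => /(_ ltr01).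
  by rewrite ltNge tauy.
split; last exact: (ge_inf hinf.2).
rewrite leNgt; apply/negP => Ftau.
have := cvgr_lt _ (cumulative_is_right_continuous F (quantile F tau)) _ Ftau.
case=> e /= e0 qe.
have [y /= tauy yq] := inf_adherent e0 hinf.
have qy : quantile F tau <= y by exact: (ge_inf hinf.2).
have [qy'|yq'] := ltP (quantile F tau) y; last first.
  by move: Ftau; rewrite ltNge (le_trans tauy)//; exact: Fnd.
have := qe y; rewrite /ball/= distrC ger0_norm ?subr_ge0// ltrBlDl.
by move=> /(_ yq qy'); rewrite ltNge tauy.
Qed.

End quantile.

Section smoothness.
Context {R : realType} {n : nat}.
Implicit Types (m : 'cV[R]_n -> R) (u : {ffun 'I_n -> nat}).

Definition partial (i : 'I_n) m : 'cV[R]_n -> R := fun x => 'D_(delta_mx i 0) m x.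

Definition partials (s : seq 'I_n) m : 'cV[R]_n -> R := foldr partial m s.

Definition mindex_order u : nat := (\sum_(i < n) u i)%N.

Definition mderiv u m : 'cV[R]_n -> R :=
  partials (flatten [seq nseq (u i) i | i <- enum 'I_n]) m.

Definition gradient m (x : 'cV[R]_n) : 'cV[R]_n := \col_i partial i m x.

Definition has_gradient m (x : 'cV[R]_n) : Prop :=
  forall i, derivable m x (delta_mx i 0).

Definition has_partials_upto (k : nat) (E : set 'cV[R]_n) m : Prop :=
  forall (s : seq 'I_n) (i : 'I_n) x, (size s < k)%N -> E x ->
    derivable (partials s m) x (delta_mx i 0).

(* On an open set E, m is differentiable up to order l when all its partial
   derivatives of order less than l are differentiable on E.  The norm on
   column vectors is the supremum norm. *)
Definition holder_with (s C : R) (E : set 'cV[R]_n) m : Prop :=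
  exists (l : nat) (g : R), [/\ 0 < g <= 1, s = l%:R + g,
    forall u x, (mindex_order u < l)%N -> E x -> differentiable (mderiv u m) x &
    forall u x1 x2, mindex_order u = l -> E x1 -> E x2 ->
      `|mderiv u m x1 - mderiv u m x2| <= C * `|x1 - x2| `^ g].

Definition holder_class (s : R) (E : set 'cV[R]_n) m : Prop :=
  exists2 C, 0 < C & holder_with s C E m.

End smoothness.

Section model.
Context {d} {T : measurableType d} {R : realType} (P : probability T R).
Variable p : nat.

Definition is_density (X : {RV P >-> 'cV[R]_p}) (f : 'cV[R]_p -> R) : Prop :=
  [/\ measurable_fun setT f, forall x, 0 <= f x &
      forall A, measurable A ->
        distribution P X A = (\int[lebesgue_cV R p]_(x in A) (f x)%:E)%E].

Definition is_cond_density (F : 'cV[R]_p -> cumulativeBounded (0 : R) (1 : R))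
    (D : set 'cV[R]_p) (f : R -> 'cV[R]_p -> R) : Prop :=
  forall x, D x ->
    [/\ measurable_fun setT (f ^~ x), forall y, 0 <= f y x &
        forall y, (F x y)%:E =
          (\int[lebesgue_measure]_(t in `]-oo, y]) (f t x)%:E)%E].

Definition cond_quantile (F : 'cV[R]_p -> cumulativeBounded (0 : R) (1 : R))
    (tau : R) (x : 'cV[R]_p) : R := quantile (F x) tau.

Variables (X : T -> 'cV[R]_p) (Q : R -> 'cV[R]_p -> R).

(* opg: outer product of gradients; copg: the composite matrix, i.e. the
   integral over tau in (0, 1) of E(opg tau), taken entrywise. *)
Definition opg (tau : R) (w : T) : 'M[R]_p :=
  gradient (Q tau) (X w) *m (gradient (Q tau) (X w))^T.

Definition copg_finite : Prop :=
  forall i j,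
    {ae lebesgue_measure, forall tau, 0 < tau < 1 ->
       P.-integrable setT (fun w => (opg tau w i j)%:E)} /\
    lebesgue_measure.-integrable `]0%R, 1%R[
      (fun tau => 'E_P[fun w => opg tau w i j]%E).

Definition copg : 'M[R]_p :=
  \matrix_(i, j) fine (\int[lebesgue_measure]_(tau in `]0%R, 1%R[)
                         'E_P[fun w => opg tau w i j])%E.

End model.

(* Main.v *)
(** Both spaces are determined by their orthogonal complements.  Since
    v^T Sigma v is the integral over tau of E[(v . grad Q_tau(X))^2], the kernel
    of Sigma consists of the v such that, for almost every tau, the directional
    derivative v . grad Q_tau vanishes almost everywhere on D.  For such tau this
    is equivalent to Q_tau being constant along v.  Only partial derivatives of
    Q_tau are available, so this equivalence is proved weakly: testing u = Q_tau
    against translates of a C^1 function phi, the integral of u(x) phi(x + t v)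
    has derivative minus that of phi(x + t v) (v . grad u)(x).  The integration
    by parts needs no continuity of the partial derivatives, because their local
    square integrability follows from the finiteness of Sigma and from the
    density of X being bounded below on compact subsets of D.

    If colspan B is a dimension reduction subspace, then Q_tau is constant along
    the kernel of B^T, so colspan Sigma is contained in colspan B.  Conversely,
    for v in the kernel of Sigma the quantiles, hence the conditional
    distribution function F, are constant along v, so F depends on x only
    through B^T x for an orthonormal basis B of colspan Sigma. *)

Require Import Defs.
From HB Require Import structures.
From mathcomp Require Import all_boot all_order all_algebra.
From mathcomp Require Import all_classical all_reals all_analysis.
From mathcomp Require Import measurable_realfun ring lra.

Set Implicit Arguments.
Unset Strict Implicit.
Unset Printing Implicit Defensive.

Import Order.TTheory GRing.Theory Num.Theory.
Import numFieldNormedType.Exports.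

Local Open Scope classical_set_scope.
Local Open Scope ring_scope.

(** * Integration by parts *)

(** Partial derivatives exist at every point of D, not merely almost everywhere, and this is what
    rules out Cantor-like behaviour: on a line, the increment of an everywhere differentiable
    function with integrable derivative is the Lebesgue integral of that derivative. The argument
    compares the function with the primitive of a lower semicontinuous majorant of its derivative,
    and Fubini then makes the integral of a partial derivative vanish for functions of bounded
    support in several variables.

    The other obstacle is that the identities at hand hold only almost surely. They are turned into
    identities between quantiles, whose continuity in x extends them to every point of D. The
    distribution function is then recovered from its quantiles at almost every level, so that only
    null sets of levels remain exceptional and no null set of x survives. *)

Section growth.
Context {R : realType}.
Implicit Types f G : R -> R.

(** [G] may jump. At the supremum of the points where the bound holds, continuity of [f] and
    monotonicity of [G] transport the bound from the left; the local hypothesis would then push it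
    further right unless the supremum is [b]. *)
Lemma right_growth_le f G (a b : R) : a <= b -> continuous f ->
  (forall x y, a <= x -> x <= y -> y <= b -> G x <= G y) ->
  (forall x, a <= x -> x < b -> \forall y \near x^'+, f y - f x <= G y - G x) ->
  f b - f a <= G b - G a.
Proof.
move=> ab cf ndG fG.
pose S := [set x | a <= x <= b /\ f x - f a <= G x - G a].
have Sa : S a by rewrite /S/= lexx ab !subrr.
have supS : has_sup S.
  by split; [exists a|exists b => x [/andP[]]].
pose s := sup S.
have as_ : a <= s by apply: ub_le_sup => //; exact: supS.2.
have sb : s <= b by apply: ge_sup => [|x [/andP[]]//]; exists a.
have Ss : S s.
  split; first by rewrite as_.
  rewrite leNgt; apply/negP => lt_s.
  pose e := f s - f a - (G s - G a).
  have e0 : 0 < e by rewrite subr_gt0.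
  have /cvgrPdist_lt/(_ _ e0)[r /= r0 fr] := cf s.
  have [x Sx xs] := sup_adherent r0 supS.
  have xles : x <= s by apply: ub_le_sup => //; exact: supS.2.
  have := fr x; rewrite /ball_/= ger0_norm ?subr_ge0// ltrBlDr.
  rewrite -ltrBlDl xs => /(_ isT).
  have [/andP[ax xb] fx] := Sx.
  have := ndG _ _ ax xles sb.
  move=> Gxs /(le_lt_trans (ler_norm _)); rewrite /e; lra.
move: sb; rewrite le_eqVlt => /predU1P[<-|sb]; first exact: Ss.2.
have [r /= r0 fr] := fG s as_ sb.
pose y := Num.min (s + r / 2) b.
have sy : s < y by rewrite /y lt_min sb andbT ltrDl divr_gt0.
have yr : y <= s + r / 2 by rewrite /y ge_min lexx.
have yb : y <= b by rewrite /y ge_min lexx orbT.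
have Sy : S y.
  split; first by rewrite yb (le_trans as_)// ltW.
  have := fr y; rewrite /ball_/= ltr0_norm ?subr_lt0// opprB.
  have -> : y - s < r by lra.
  move=> /(_ isT sy); have := Ss.2; lra.
have : y <= s by apply: ub_le_sup => //; exact: supS.2.
by rewrite leNgt sy.
Qed.

End growth.

Lemma ge0_integral_scale_indic d (T : measurableType d) (R : realType)
    (mu : {measure set T -> \bar R}) (D A : set T) (e : R) :
  measurable D -> measurable A -> 0 <= e ->
  (\int[mu]_(x in D) (e * \1_A x)%:E = e%:E * mu (A `&` D))%E.
Proof.
move=> mD mA e0; under eq_integral do rewrite EFinM.
rewrite ge0_integralZl ?integral_indic//.
by apply/measurable_EFinP; exact: measurable_indic.
Qed.

Section lsc_majorant.
Context {R : realType}.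
Local Notation mu := (@lebesgue_measure R).

Lemma sum_layers_le (h e : R) (n : nat) : 0 <= h -> 0 < e ->
  \sum_(k < n) (e * (k%:R * e < h)%R%:R) <= h + e.
Proof.
move=> h0 e0.
(* The extra bound [n%:R * e] drives the induction: when layer [n] counts, [n%:R * e < h], so adding
   [e] to it stays below [h + e]. *)
suff: \sum_(k < n) (e * (k%:R * e < h)%R%:R) <= Num.min (n%:R * e) (h + e).
  by rewrite le_min => /andP[].
elim: n => [|n IH]; first by rewrite big_ord0 mul0r le_min lexx addr_ge0// ltW.
rewrite big_ord_recr/=; move: IH; rewrite !le_min => /andP[S1 S2].
rewrite -natr1 mulrDl mul1r; case: ltP => [neh|]; rewrite ?mulr1 ?mulr0 ?addr0.
  by rewrite !lerD2r S1/= (le_trans S1)// ltW.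
by rewrite S2 andbT (le_trans S1)// lerDl ltW.
Qed.

(* Vitali-Caratheodory: the layers [h > k e] are enclosed in open sets U k of
   almost the same measure, and the majorant is e times the sum of the
   indicators of the U k. *)
Lemma lsc_majorant (h : R -> R) (a b e : R) : a <= b -> 0 < e ->
  measurable_fun `[a, b] h -> (forall x, 0 <= h x) ->
  exists g : R -> \bar R, [/\ measurable_fun [set: R] g, forall x, (0 <= g x)%E,
    (\int[mu]_(x in `[a, b]) g x <=
       \int[mu]_(x in `[a, b]) (h x)%:E + (e * (b - a + 1))%:E)%E &
    forall x, x \in `[a, b] -> \forall y \near x, ((h x)%:E <= g y)%E].
Proof.
move=> ab e0 mh h0; have e0' := ltW e0.
pose E k := `[a, b] `&` [set x | k%:R * e < h x].
have mE k : measurable (E k).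
  have := mh (measurable_itv _) _ (measurable_itv `]k%:R * e, +oo[).
  by rewrite set_itvoy.
have muab : mu `[a, b] = (b - a)%:E.
  rewrite lebesgue_measure_itv/= lte_fin; case: ltgtP ab => // -> _.
  by rewrite subrr.
have muE k : (mu (E k) < +oo)%E.
  apply: (@le_lt_trans _ _ (mu `[a, b])); last by rewrite muab ltry.
  by apply: le_measure; rewrite ?inE//; [exact: mE|move=> ? []].
(* The excess measures sum to at most 1, which after scaling by [e] gives one [e] of the error
   [e * (b - a + 1)]. The remaining [e * (b - a)] pays for rounding [h] up to whole layers. *)
have Uex k : {U : set R | [/\ open U, E k `<=` U &
    (mu (U `\` E k) < (1 / (2 ^ k.+1)%:R)%:E)%E]}.
  apply: cid; apply: (lebesgue_regularity_outer (mE k) (muE k)).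
  by rewrite divr_gt0// ltr0n expn_gt0.
pose U k := sval (Uex k).
have oU k : open (U k) by have [] := svalP (Uex k).
have EU k : E k `<=` U k by have [] := svalP (Uex k).
have mU k : measurable (U k) by exact: open_measurable.
have muU k : (mu (U k `&` `[a, b]) <= mu (E k) + (1 / (2 ^ k.+1)%:R)%:E)%E.
  apply: (@le_trans _ _ (mu (U k))).
    apply: le_measure; [|by rewrite inE; exact: mU|by move=> ? []].
    by rewrite inE; apply: measurableI => //; exact: mU.
  rewrite -[in leLHS](setDUK (EU k)) measureU//.
  - by rewrite leeD2l// ltW//; have [] := svalP (Uex k).
  - exact: mE.
  - by apply: measurableD; [exact: mU|exact: mE].
  - by rewrite setDIK.
pose g y := (\sum_(0 <= k <oo) (e * \1_(U k) y)%:E)%E.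
have g1 k y : (0 <= (e * \1_(U k) y)%:E)%E.
  by rewrite lee_fin mulr_ge0// ltW.
have mg1 k D : measurable_fun D (fun y => (e * \1_(U k) y)%:E).
  by apply/measurable_EFinP; apply: measurable_funM => //; exact: measurable_indic.
have mE1 k D : measurable_fun D (fun y => (e * \1_(E k) y)%:E).
  by apply/measurable_EFinP; apply: measurable_funM => //; exact: measurable_indic.
exists g; split.
- by apply: ge0_emeasurable_sum => // k _; exact: mg1.
- by move=> x; apply: nneseries_ge0 => k _ _.
- rewrite /g integral_nneseries//; last by move=> n; exact: mg1.
  have intU k : (\int[mu]_(x in `[a, b]) (e * \1_(U k) x)%:E =
      e%:E * mu (U k `&` `[a, b]))%E.
    by apply: ge0_integral_scale_indic => //; exact: mU.
  under eq_eseriesr do rewrite intU.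
  rewrite nneseriesZl//.
  apply: (@le_trans _ _ (e%:E * (\sum_(0 <= k <oo) mu (E k) + 1%:E))%E).
    rewrite lee_pmul2l//; apply: le_trans; last first.
      by apply: (@epsilon_trick _ (fun k => mu (E k)) 1 xpredT).
    by apply: lee_nneseries.
  rewrite ge0_muleDr ?nneseries_ge0//.
  rewrite -nneseriesZl//.
  rewrite (_ : (e * (b - a + 1))%:E = (e%:E * mu `[a, b] + e%:E * 1%:E)%E); last first.
    by rewrite muab -!EFinM -EFinD; congr EFin; ring.
  rewrite addeA leeD2r//.
  have intE k : (e%:E * mu (E k) =
      \int[mu]_(x in `[a, b]) (e * \1_(E k) x)%:E)%E.
    rewrite -[in LHS](@setIidl _ (E k) `[a, b]); last by move=> ? [].
    by apply/esym; apply: ge0_integral_scale_indic => //; exact: mE.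
  under eq_eseriesr do rewrite intE.
  have E1 k x : (0 <= (e * \1_(E k) x)%:E)%E by rewrite lee_fin mulr_ge0.
  have <- : (\int[mu]_(x in `[a, b]) \sum_(0 <= k <oo) (e * \1_(E k) x)%:E =
      \sum_(0 <= k <oo) \int[mu]_(x in `[a, b]) (e * \1_(E k) x)%:E)%E.
    by apply: integral_nneseries => // k; exact: mE1.
  have <- : (\int[mu]_(x in `[a, b]) ((h x)%:E + e%:E) =
      \int[mu]_(x in `[a, b]) (h x)%:E + e%:E * mu `[a, b])%E.
    rewrite -[in RHS]integral_cst//; apply: ge0_integralD => //.
      by move=> x _; rewrite lee_fin.
    by apply/measurable_EFinP.
  apply: ge0_le_integral => //.
  + by move=> x _; apply: nneseries_ge0.
  + by apply: ge0_emeasurable_sum => // k _; exact: mE1.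
  + by apply: emeasurable_funD => //; apply/measurable_EFinP.
  + move=> x abx; apply: lime_le.
      by apply: is_cvg_nneseries.
    apply: nearW => n /=; rewrite big_mkord sumEFin lee_fin.
    apply: le_trans (@sum_layers_le (h x) e n (h0 x) e0).
    apply: ler_sum => k _; rewrite ler_wpM2l//.
    rewrite indicE; case: (boolP (x \in E k)) => //; rewrite inE => -[_ /= ->].
    by rewrite lexx.
- move=> x xab.
  pose m := (Num.truncn (h x / e)).+1.
  have hm : h x <= m%:R * e.
    by rewrite -ler_pdivrMr// ltW// truncnS_gt.
  (* For the least [n] with [h x <= n%:R * e], the point [x] lies in the first [n] layers, hence in
     [U 0], ..., [U n.-1]. Their intersection is a neighbourhood of [x] on which the majorant is at
     least [n%:R * e]. *)
  have [n [hn Hn]] : exists n, h x <= n%:R * e /\ forall k, (k < n)%N -> k%:R * e < h x.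
    have ex : exists n, h x <= n%:R * e by exists m.
    case: (ex_minnP ex) => n hn nmin; exists n; split => // k kn.
    by rewrite ltNge; apply/negP => /nmin; rewrite leqNgt kn.
  have : nbhs (x : R) [set y : R | forall k, (k < n)%N -> U k y].
    elim: n Hn {hn} => [_|n IH Hn]; first by apply: (@nearW R (nbhs x)) => y k.
    have Un : nbhs (x : R) (U n).
      by apply: open_nbhs_nbhs; split=> //; apply: EU; split=> //=; exact: Hn.
    apply: filterS2 Un (IH (fun k kn => Hn k (ltnW kn))) => y Uny Uy k.
    by rewrite ltnS leq_eqVlt => /predU1P[->//|]; exact: Uy.
  apply: filterS => y Uy.
  apply: (@le_trans _ _ (\sum_(0 <= k < n) (e * \1_(U k) y)%:E)%E); last first.
    exact: nneseries_lim_ge.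
  rewrite big_mkord sumEFin lee_fin (eq_bigr (fun=> e)).
    by rewrite sumr_const card_ord -mulr_natl.
  by move=> k _; rewrite indicE mem_set ?mulr1//; exact: Uy.
Qed.

End lsc_majorant.

Section ftc.
Context {R : realType}.
Local Notation mu := (@lebesgue_measure R).

Lemma derivable_slope_le (f : R -> R) (x e : R) : derivable f x 1 -> 0 < e ->
  \forall y \near x^'+, f y - f x <= ('D_1 f x + e) * (y - x).
Proof.
move=> dfx e0.
have /cvgrPdist_lt/(_ _ e0)[r /= r0 fr] := dfx.
exists r => //= y /=; rewrite distrC => xyr xy.
have yx : 0 < y - x by rewrite subr_gt0.
have := fr (y - x); rewrite /ball_/= sub0r normrN xyr subr_eq0 gt_eqF//.
move=> /(_ isT isT); rewrite scaler1 subrK distrC -/('D_1 f x).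
move=> /(le_lt_trans (ler_norm _)); rewrite ltrBlDl => /ltW.
by rewrite [_ *: _]mulrC ler_pdivrMr.
Qed.

(** Truncating below and adding [n] gives a nonnegative [h], which has a majorant [g] with primitive
    [G]. Just to the right of [x], the function [f x + (n%:R - e) * x] has slope at most
    ['D_1 f x + n%:R <= h x <= g], so it grows no faster than [G]. The error is [e * (b - a + 1)]
    from the majorant and [e * (b - a)] from the slopes. *)
Lemma le_integral_deriv_trunc (f : R -> R) (a b e : R) (n : nat) :
  a <= b -> 0 < e -> (forall x, derivable f x 1) ->
  mu.-integrable `[a, b] (fun x => ('D_1 f x)%:E) ->
  ((f b - f a)%:E <= \int[mu]_(x in `[a, b]) (Num.max ('D_1 f x) (- n%:R))%:E
     + (e * (2 * (b - a) + 1))%:E)%E.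
Proof.
move=> ab e0 df iD.
pose h x := Num.max ('D_1 f x) (- n%:R) + n%:R.
have h0 x : 0 <= h x by rewrite -lerBlDr sub0r le_max lexx orbT.
have mD : measurable_fun `[a, b] (fun x => 'D_1 f x).
  by have /integrableP[/measurable_EFinP] := iD.
have mmax : measurable_fun `[a, b] (fun x => Num.max ('D_1 f x) (- n%:R)).
  exact: measurable_maxr.
have mh : measurable_fun `[a, b] h by exact: measurable_funD.
have mab : measurable (`[a, b] : set (measurableTypeR R)) by exact: measurable_itv.
have muab : mu `[a, b] = (b - a)%:E.
  rewrite lebesgue_measure_itv/= lte_fin; case: ltgtP ab => // -> _.
  by rewrite subrr.
have ltab : (mu `[a, b] < +oo)%E by rewrite muab ltry.
have cstI (c : R) : mu.-integrable `[a, b] (fun=> c%:E).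
  apply: (@measurable_bounded_integrable _ _ _ mu (cst c)) => //.
  exact: bounded_cst.
have imax : mu.-integrable `[a, b] (fun x => (Num.max ('D_1 f x) (- n%:R))%:E).
  have iDn := integrableD mab (integrable_abse iD) (cstI n%:R).
  apply: (le_integrable mab _ _ iDn).
    by apply/measurable_EFinP.
  move=> x _ /=; rewrite lee_fin [leRHS]ger0_norm ?addr_ge0//.
  case: (leP ('D_1 f x) (- n%:R)) => _; rewrite ?lerDl//.
  by rewrite normrN normr_nat lerDr.
have ih : mu.-integrable `[a, b] (fun x => (h x)%:E).
  exact: (integrableD mab imax (cstI n%:R)).
have [g [mg g0 gint hg]] := lsc_majorant ab e0 mh h0.
have fin_h := integrable_fin_num mab ih.
have mgD (D : set R) : measurable_fun D g by exact: measurable_funTS mg.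
have gfin (x y : R) : a <= x -> y <= b ->
    (\int[mu]_(z in `]x, y]) g z)%E \is a fin_num.
  move=> ax yb; rewrite ge0_fin_numE ?integral_ge0//.
  apply: (@le_lt_trans _ _ (\int[mu]_(z in `[a, b]) g z)%E).
    apply: ge0_subset_integral => //; first exact: mgD.
    by apply: subset_itv; rewrite bnd_simp.
  by rewrite (le_lt_trans gint)// -(fineK fin_h) -EFinD ltry.
pose G x := fine (\int[mu]_(z in `]a, x]) g z)%E.
have GB x y : a <= x -> x <= y -> y <= b ->
    G y - G x = fine (\int[mu]_(z in `]x, y]) g z)%E.
  move=> ax xy yb; rewrite /G.
  have -> : `]a, y]%classic = `]a, x]%classic `|` `]x, y]%classic :> set R.
    by apply: itv_bndbnd_setU; rewrite bnd_simp.
  rewrite ge0_integral_setU//; [|exact: mgD|].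
    by rewrite fineD ?gfin//; [rewrite addrAC subrr add0r|rewrite (le_trans xy)].
  apply/disj_set2P; rewrite -subset0 => z /=; rewrite !in_itv/=.
  by case=> /andP[_ zx] /andP[/lt_geF]; rewrite zx.
have := @right_growth_le _ (fun x => f x + (n%:R - e) * x) G a b ab.
have -> : G a = 0 by rewrite /G set_itvoc0 integral_set0.
have Gb : G b <= fine (\int[mu]_(x in `[a, b]) (h x)%:E)%E + e * (b - a + 1).
  rewrite -lee_fin EFinD /G fineK ?gfin// fineK// (le_trans _ gint)//.
  apply: ge0_subset_integral => //; first exact: mgD.
  by apply: subset_itv; rewrite bnd_simp.
have hint : fine (\int[mu]_(x in `[a, b]) (h x)%:E)%E =
    fine (\int[mu]_(x in `[a, b]) (Num.max ('D_1 f x) (- n%:R))%:E)%E + n%:R * (b - a).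
  rewrite [X in fine X](_ : _ = \int[mu]_(x in `[a, b])
     ((Num.max ('D_1 f x) (- n%:R))%:E + n%:R%:E))%E; last by apply: eq_integral.
  rewrite integralD//= fineD ?integrable_fin_num//; congr (_ + _).
  by rewrite integral_cst//= muab.
move=> H.
rewrite -[X in (_ <= X + _)%E]fineK ?integrable_fin_num// -EFinD lee_fin.
suff : f b + (n%:R - e) * b - (f a + (n%:R - e) * a) <= G b - 0 by lra.
apply: H => [x|x y ax xy yb|x ax xb].
- apply: continuousD; last exact: mulrl_continuous.
  by apply/differentiable_continuous/derivable1_diffP.
- by rewrite -subr_ge0 GB// fine_ge0// integral_ge0.
have /hg[r /= r0 hr] : x \in `[a, b] by rewrite in_itv/= ax ltW.
have [s /= s0 fs] := derivable_slope_le (df x) e0.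
exists (Num.min (Num.min r s) (b - x)) => /=.
  by rewrite !lt_min r0 s0 subr_gt0.
move=> y /=; rewrite !lt_min => /andP[/andP[yr ys] yb] xy.
have {}yb : y <= b.
  by move: yb; rewrite distrC gtr0_norm ?subr_gt0//; lra.
rewrite GB//; last exact: ltW.
have fy := fs _ ys xy.
suff : h x * (y - x) <= fine (\int[mu]_(z in `]x, y]) g z)%E.
  have Dh : 'D_1 f x + n%:R <= h x by rewrite lerD2r le_max lexx.
  have : ('D_1 f x + n%:R) * (y - x) <= h x * (y - x).
    by rewrite ler_wpM2r// subr_ge0 ltW.
  lra.
rewrite -lee_fin fineK ?gfin//.
have muxy : mu `]x, y] = (y - x)%:E.
  by rewrite lebesgue_measure_itv/= lte_fin xy.
rewrite EFinM -muxy -integral_cst//.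
apply: ge0_le_integral => //.
- by move=> z _; rewrite lee_fin.
- exact: mgD.
move=> z; rewrite /= in_itv/= => /andP[xz zy]; apply: hr => /=.
rewrite distrC gtr0_norm ?subr_gt0//.
by move: yr; rewrite distrC gtr0_norm ?subr_gt0//; lra.
Qed.

(* The derivative need not be continuous, so the usual fundamental theorem of
   calculus does not apply. *)
Lemma le_integral_deriv (f : R -> R) (a b : R) :
  a <= b -> (forall x, derivable f x 1) ->
  mu.-integrable `[a, b] (fun x => ('D_1 f x)%:E) ->
  ((f b - f a)%:E <= \int[mu]_(x in `[a, b]) ('D_1 f x)%:E)%E.
Proof.
move=> ab df iD.
have mD : measurable_fun `[a, b] (fun x => 'D_1 f x).
  by have /integrableP[/measurable_EFinP] := iD.
have mab : measurable (`[a, b] : set (measurableTypeR R)) by exact: measurable_itv.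
have Hn n : ((f b - f a)%:E <=
    \int[mu]_(x in `[a, b]) (Num.max ('D_1 f x) (- n%:R))%:E)%E.
  apply/lee_addgt0Pr => e e0.
  have c0 : 0 < 2 * (b - a) + 1 by rewrite ltr_wpDl// mulr_ge0// subr_ge0.
  have := @le_integral_deriv_trunc f a b (e / (2 * (b - a) + 1)) n ab.
  by rewrite divfK ?gt_eqF//; apply => //; rewrite divr_gt0.
(* The truncations are dominated by the absolute value of the derivative and equal it once [n] is
   large, so dominated convergence removes them. *)
pose g n x := Num.max ('D_1 f x) (- n%:R).
have mg n : measurable_fun `[a, b] (fun x => (g n x)%:E).
  by apply/measurable_EFinP; exact: measurable_maxr.
have mDE : measurable_fun `[a, b] (fun x => ('D_1 f x)%:E).
  by apply/measurable_EFinP.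
have gD : {ae mu, forall x, `[a, b]%classic x ->
    ((g n x)%:E @[n --> \oo] --> ('D_1 f x)%:E)%E}.
  apply: aeW => x _; apply: cvg_near_cst; exists (Num.truncn `|'D_1 f x|).+1 => //= n /= tn.
  congr EFin; apply/max_idPl; rewrite lerNl (le_trans (ler_norm _))// normrN.
  by rewrite (le_trans (ltW (truncnS_gt _)))// ler_nat.
have gle : {ae mu, forall x n, `[a, b]%classic x ->
    (`|(g n x)%:E| <= `|('D_1 f x)%:E|)%E}.
  apply: aeW => x n _; rewrite lee_fin /g; case: (leP ('D_1 f x) (- n%:R)) => // Dn.
  have nD : n%:R <= - 'D_1 f x by rewrite lerNr.
  by rewrite normrN normr_nat (le_trans nD)// -normrN ler_norm.
have [_ _ cvgI] := dominated_convergence mab mg mDE gD (integrable_abse iD) gle.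
by apply: (cvge_ge _ cvgI); exact: nearW.
Qed.

End ftc.

(** * Slicing column vectors along the first coordinate *)

Section lebesgue_cV_cons.
Context {R : realType}.
Local Notation la := (@lebesgue_measure R).

Lemma ge0_integral_lebesgue_cVS n (f : 'cV[R]_n.+1 -> \bar R) :
  measurable_fun setT f -> (forall z, (0 <= f z)%E) ->
  (\int[lebesgue_cV R n.+1]_z f z =
   \int[la \x lebesgue_cV R n]_z f (cons_cV z))%E.
Proof.
move=> mf f0.
have := @ge0_integral_pushforward _ _ _ _ R _ (@measurable_cons_cV R n)
  (la \x lebesgue_cV R n)%E setT f measurableT mf (fun z _ => f0 z).
by rewrite preimage_setT.
Qed.

Lemma integrable_lebesgue_cVS n (f : 'cV[R]_n.+1 -> \bar R) :
  (lebesgue_cV R n.+1).-integrable setT f ->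
  (la \x lebesgue_cV R n)%E.-integrable setT (f \o @cons_cV R n).
Proof.
move=> /integrableP[mf foo]; apply/integrableP; split.
  by apply: measurableT_comp => //; exact: measurable_cons_cV.
rewrite ge0_integral_lebesgue_cVS// in foo.
exact: measurableT_comp.
Qed.

Lemma integral_lebesgue_cVS n (f : 'cV[R]_n.+1 -> \bar R) :
  (lebesgue_cV R n.+1).-integrable setT f ->
  (\int[lebesgue_cV R n.+1]_z f z =
   \int[la \x lebesgue_cV R n]_z f (cons_cV z))%E.
Proof.
move=> fi; have fi' := integrable_lebesgue_cVS fi.
have := @integral_pushforward _ _ _ _ R _ (@measurable_cons_cV R n)
  (la \x lebesgue_cV R n)%E setT f (measurable_int _ fi).
by rewrite preimage_setT; apply.
Qed.

Lemma cons_cV0 n (t : R) (x : 'cV[R]_n) : cons_cV (t, x) ord0 0 = t.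
Proof. by have /(congr1 fst) := cons_cVK (t, x). Qed.

Lemma cons_cV_lift n (t : R) (x : 'cV[R]_n) j :
  cons_cV (t, x) (lift ord0 j) 0 = x j 0.
Proof.
have -> : lift ord0 j = rshift 1 j by apply/val_inj.
by rewrite /cons_cV (@col_mxEd _ 1 n 1).
Qed.

Lemma cons_cVD_delta0 n (h t : R) (x : 'cV[R]_n) :
  h *: delta_mx ord0 0 + cons_cV (t, x) = cons_cV (h + t, x).
Proof.
apply/matrixP => i j; rewrite ord1 [LHS]mxE [X in X + _]mxE [X in _ * X]mxE.
case: (unliftP ord0 i) => [k|] ->; rewrite ?cons_cV0 ?cons_cV_lift ?eqxx ?mulr1//.
by rewrite /= mulr0 add0r.
Qed.

Lemma cons_cVD_delta_lift n (h t : R) (x : 'cV[R]_n) j :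
  h *: delta_mx (lift ord0 j) 0 + cons_cV (t, x) =
  cons_cV (t, h *: delta_mx j 0 + x).
Proof.
apply/matrixP => i k; rewrite ord1 [LHS]mxE [X in X + _]mxE [X in _ * X]mxE.
case: (unliftP ord0 i) => [k'|] ->; rewrite ?cons_cV0 ?cons_cV_lift.
  by rewrite !mxE eqxx !andbT (inj_eq (@lift_inj _ _)).
by rewrite /= mulr0 add0r.
Qed.

Lemma coord_le_norm m n (M : 'M[R]_(m, n)) i j : `|M i j| <= `|M|.
Proof.
rewrite [leRHS]/Num.norm/= mx_normrE.
by apply: (le_bigmax _ (fun ij => `|M ij.1 ij.2|) (i, j)).
Qed.

Lemma le_norm_cons_cV1 n (t : R) (x : 'cV[R]_n) : `|t| <= `|cons_cV (t, x)|.
Proof. by rewrite -[t in leLHS](cons_cV0 t x) coord_le_norm. Qed.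

Lemma mx_norm_le m n (M : 'M[R]_(m, n)) (c : R) : 0 <= c ->
  (forall i j, `|M i j| <= c) -> `|M| <= c.
Proof.
move=> c0 Mc; rewrite /Num.norm/= mx_normrE.
by apply: bigmax_le => // -[i j] _; exact: Mc.
Qed.

Lemma le_norm_cons_cV2 n (t : R) (x : 'cV[R]_n) : `|x| <= `|cons_cV (t, x)|.
Proof.
apply: mx_norm_le => // i j; rewrite ord1 -[x i 0](cons_cV_lift t).
exact: coord_le_norm.
Qed.

End lebesgue_cV_cons.

Section derive_affine.
Context {R : numFieldType} {U V W : normedModType R}.
Variables (f : V -> W) (g : U -> V) (a u : U) (v : V).
Hypothesis gE : forall h : R, g (h *: u + a) = h *: v + g a.

Let quotientE : (fun h : R => h^-1 *: ((f \o g \o shift a) (h *: u) - (f \o g) a)) =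
  (fun h => h^-1 *: ((f \o shift (g a)) (h *: v) - f (g a))).
Proof. by apply/funext => h; rewrite /= gE. Qed.

(** [g] is affine only along the line through [a] with direction [u], which it sends to the line
    through [g a] with direction [v]; the two difference quotients are the same function of [h]. *)
Lemma derivable_affineE : derivable (f \o g) a u = derivable f (g a) v.
Proof. by rewrite /derivable quotientE. Qed.

Lemma derive_affineE : 'D_u (f \o g) a = 'D_v f (g a).
Proof. by rewrite /derive quotientE. Qed.

End derive_affine.

Section integral_partial.
Context {R : realType}.
Local Notation la := (@lebesgue_measure R).

(** The one-sided inequality is applied to [f] and to [- f] on an interval [[- c, c]] with [c > M]:
    [f] vanishes at both ends, and its derivative vanishes outside. *)
Lemma integral_deriv_bounded_support (f : R -> R) (M : R) :
  (forall x, derivable f x 1) -> (forall x, M <= `|x| -> f x = 0) ->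
  la.-integrable setT (fun x => ('D_1 f x)%:E) ->
  (\int[la]_x ('D_1 f x)%:E = 0)%E.
Proof.
move=> df f0 iD; pose c := `|M| + 1.
have Mc : M < c by rewrite (le_lt_trans (ler_norm _))// ltrDl.
have c0 : 0 <= c by rewrite addr_ge0.
have cc : - c <= c by rewrite ge0_cp.
have mc : measurable (`[- c, c] : set (measurableTypeR R)) by exact: measurable_itv.
have D0 x : ~ `[- c, c]%classic x -> 'D_1 f x = 0.
  move=> /= /negP; rewrite in_itv/= -ler_norml -ltNge => cx.
  rewrite -(derive_cst (0 : R) x 1); apply: near_eq_derive => //.
  have : \forall y \near x, c < `|y|.
    have := @norm_continuous _ _ x; move/cvgrPdist_lt => /(_ (`|x| - c)).
    rewrite subr_gt0 => /(_ cx); apply: filterS => y /=.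
    by move=> /(le_lt_trans (ler_norm _)); lra.
  apply: filterS => y /= cy; apply: f0; exact/ltW/(lt_trans Mc).
have DE : (fun x => ('D_1 f x)%:E) = (fun x => ('D_1 f x)%:E) \_ `[- c, c].
  apply/funext => x; rewrite patchE; case: ifPn => //.
  by rewrite notin_setE => /D0 ->.
have iDc : la.-integrable `[- c, c] (fun x => ('D_1 f x)%:E).
  exact: integrableS iD.
rewrite DE -integral_mkcond.
have fc : f c = 0 by apply: f0; rewrite ger0_norm// ltW.
have fNc : f (- c) = 0 by apply: f0; rewrite normrN ger0_norm// ltW.
have ge0 := le_integral_deriv cc df iDc.
have dNf x : derivable (- f) x 1 by exact: derivableN.
have DN : (fun x => ('D_1 (- f) x)%:E) = (fun x => - ('D_1 f x)%:E)%E.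
  by apply/funext => x; rewrite deriveN.
have iDNc : la.-integrable `[- c, c] (fun x => ('D_1 (- f) x)%:E).
  by rewrite DN; exact: integrableN.
have le0 := le_integral_deriv cc dNf iDNc.
rewrite DN integralN in le0; last first.
  by apply: integrable_add_def.
move: ge0 le0; rewrite !fctE fc fNc !(oppr0, subr0) => ge0.
by rewrite leeNr oppe0 => le0; apply/eqP; rewrite eq_le le0 ge0.
Qed.

(** Induction on the dimension with Fubini. For the first coordinate, almost every line is handled
    by the one-variable result; for a later coordinate, almost every slice with fixed first entry is
    handled by the induction hypothesis. *)
Lemma integral_partial_eq0 n (i : 'I_n) (w : 'cV[R]_n -> R) (M : R) :
  (forall x, derivable w x (delta_mx i 0)) ->
  (forall x, M <= `|x| -> w x = 0) ->
  (lebesgue_cV R n).-integrable setT (fun x => (partial i w x)%:E) ->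
  (\int[lebesgue_cV R n]_x (partial i w x)%:E = 0)%E.
Proof.
elim: n i w => [[]//|n IH] i w dw w0 iw.
have iw' := integrable_lebesgue_cVS iw.
rewrite integral_lebesgue_cVS//.
case: (unliftP ord0 i) => [j|] ij; subst i.
  have line (t : R) (x : 'cV[R]_n) h :
      cons_cV (t, h *: delta_mx j 0 + x) =
      h *: delta_mx (lift ord0 j) 0 + cons_cV (t, x).
    by rewrite cons_cVD_delta_lift.
  have pE (t : R) x : partial (lift ord0 j) w (cons_cV (t, x)) =
      partial j (fun x => w (cons_cV (t, x))) x.
    by rewrite /partial -(derive_affineE _ (line t x)).
  rewrite -(fubini1 iw').
  rewrite (ae_eq_integral (cst 0%E)) ?integral0//.
    exact: measurable_int (integrable_fubini_F iw').
  apply: filterS (ae_integrable1 iw') => t it _.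
  rewrite /fubini_F/=; under eq_integral do rewrite pE.
  apply: IH => [x|x Mx|].
  - by rewrite (derivable_affineE _ (line t x)); exact: dw.
  - by apply: w0; rewrite (le_trans Mx)// le_norm_cons_cV2.
  - by apply: eq_integrable it => // x _; rewrite /= pE.
have line (x : 'cV[R]_n) (t : R) h : cons_cV (h *: 1 + t, x) =
    h *: delta_mx ord0 0 + cons_cV (t, x).
  by rewrite cons_cVD_delta0 /GRing.scale/= mulr1.
have pE (t : R) x : partial ord0 w (cons_cV (t, x)) =
    'D_1 (fun t => w (cons_cV (t, x))) t.
  exact: esym (derive_affineE w (line x t)).
rewrite -(fubini2 iw').
rewrite (ae_eq_integral (cst 0%E)) ?integral0//.
  exact: (measurable_fubini_G iw').
apply: filterS (ae_integrable2 iw') => x ix _.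
rewrite /fubini_G/=; under eq_integral do rewrite pE.
apply: (@integral_deriv_bounded_support _ M) => [t|t Mt|].
- suff : derivable (w \o (fun t : R => cons_cV (t, x))) t 1 by [].
  by rewrite (derivable_affineE w (line x t)); exact: dw.
- by apply: w0; rewrite (le_trans Mt)// le_norm_cons_cV1.
- by apply: eq_integrable ix => // t _; rewrite /= pE.
Qed.

End integral_partial.

(** * Open sets and translations of column vectors *)

Section cV_borel.
Context {R : realType}.

Lemma mx_norm_lt m n (M : 'M[R]_(m, n)) (c : R) : 0 < c ->
  (forall i j, `|M i j| < c) -> `|M| < c.
Proof.
move=> c0 Mc; rewrite /Num.norm/= mx_normrE.
by apply: bigmax_lt => // -[i j] _; exact: Mc.
Qed.

Lemma ball_cVE n (x : 'cV[R]_n) (e : R) : 0 < e ->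
  ball x e = [set y | forall i, `]x i 0 - e, x i 0 + e[%classic (y i 0)].
Proof.
move=> e0; rewrite -ball_normE; apply/seteqP; split => y /=.
  move=> xy i; have := le_lt_trans (coord_le_norm (x - y) i 0) xy.
  by rewrite !mxE in_itv/= ltr_norml; lra.
move=> xy; apply: mx_norm_lt => // i j; rewrite ord1 !mxE.
by have := xy i; rewrite in_itv/= ltr_norml; lra.
Qed.

Lemma ball_cV0 n (x : 'cV[R]_n) (e : R) : e <= 0 -> ball x e = set0.
Proof.
move=> e0; rewrite -ball_normE -subset0 => y /= /lt_le_trans/(_ e0).
by rewrite normr_lt0.
Qed.

Lemma measurable_ball_cV n (x : 'cV[R]_n) (e : R) : measurable (ball x e).
Proof.
have [e0|e0] := ltP 0 e; last by rewrite ball_cV0.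
have -> : ball x e = \bigcap_(i in [set: 'I_n])
    ((fun y : 'cV[R]_n => y i 0) @^-1` `]x i 0 - e, x i 0 + e[%classic).
  rewrite ball_cVE//.
  by apply/seteqP; split => [y Ay i _|y Ay i]; exact: Ay.
apply: fin_bigcap_measurable; first exact: finite_finset.
move=> i _; rewrite -[X in measurable X]setTI.
exact: measurable_matrix_entry.
Qed.

Lemma rat_ball_cV n (x : 'cV[R]_n) (e : R) : 0 < e ->
  exists q : 'cV[rat]_n, ball x e (map_mx ratr q).
Proof.
move=> e0.
have H i : {q : rat | ratr q \in `]x i 0 - e, x i 0 + e[}.
  by apply: cid; apply: rat_in_itvoo; lra.
exists (\col_i sval (H i)); rewrite ball_cVE// => i.
by rewrite !mxE; exact: svalP (H i).
Qed.

(** Since the sigma-algebra is generated by the entries, an open set is written as the union of the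
    countably many balls with rational centre and radius [k.+1%:R^-1] that it contains. *)
Lemma open_measurable_cV n (U : set 'cV[R]_n) : open U -> measurable U.
Proof.
move=> oU.
pose B (qk : 'cV[rat]_n * nat) : set 'cV[R]_n := ball (map_mx ratr qk.1 : 'cV[R]_n) (qk.2.+1%:R^-1).
pose C (qk : 'cV[rat]_n * nat) := if pselect (B qk `<=` U) then B qk else set0.
rewrite (_ : U = \bigcup_qk C qk).
  apply: countable_bigcupT_measurable; first exact: countableP.
  move=> qk; rewrite /C; case: pselect => /= BU; last exact: measurable0.
  exact: (measurable_ball_cV (map_mx ratr qk.1)).
apply/seteqP; split => x; last first.
  by move=> [qk _]; rewrite /C; case: pselect => // BU /BU.
move=> Ux; have /nbhs_ballP[e /= e0 eU] : nbhs x U by exact: open_nbhs_nbhs.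
pose k := Num.truncn (2 / e).
have k0 : (0 : R) < k.+1%:R^-1 by rewrite invr_gt0.
have ke : k.+1%:R^-1 < e / 2.
  by rewrite -[e / 2]invrK invf_div ltf_pV2 ?posrE ?divr_gt0// truncnS_gt.
have [q xq] := rat_ball_cV x k0.
exists (q, k) => //; rewrite /C; case: pselect => [?|]; first exact: ball_sym.
case=> y; rewrite /B/= => qy; apply: eU.
by apply: (@ball_split _ _ (map_mx ratr q : 'cV[R]_n)); [apply: le_ball xq|apply: le_ball qy]; exact: ltW.
Qed.

Lemma open_continuous_measurable_cV n (E : set 'cV[R]_n) (f : 'cV[R]_n -> R) :
  open E -> {in E, continuous f} -> measurable_fun E f.
Proof.
move=> oE cf; apply: (measurability _ (RGenOpens.measurableE R)).
move=> _ [_ [a [b ->] <-]]; apply: open_measurable_cV.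
rewrite openE => x [Ex fx]; apply: filterI; first exact: open_nbhs_nbhs.
by apply: cf; [rewrite inE|apply: open_nbhs_nbhs; split => //; exact: interval_open].
Qed.

Lemma lebesgue_cV_ball n (x : 'cV[R]_n) (e : R) : 0 < e ->
  lebesgue_cV R n (ball x e) = ((e *+ 2) ^+ n)%:E.
Proof.
move=> e0; rewrite ball_cVE//.
have -> := @lebesgue_cV_box R n (fun i => `]x i 0 - e, x i 0 + e[%classic)
  (fun i => measurable_itv _).
rewrite (eq_bigr (fun=> (e *+ 2)%:E)).
  by rewrite prodEFin prodr_const card_ord.
move=> i _; rewrite lebesgue_measure_itv/= lte_fin -EFinB.
by rewrite ifT; [congr EFin; lra|lra].
Qed.

Lemma lebesgue_cV_ball_lty n (x : 'cV[R]_n) (e : R) :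
  (lebesgue_cV R n (ball x e) < +oo)%E.
Proof.
have [e0|e0] := ltP 0 e; last by rewrite ball_cV0// measure0.
by rewrite lebesgue_cV_ball// ltry.
Qed.

Lemma lebesgue_cV_open_gt0 n (U : set 'cV[R]_n) : open U -> U !=set0 ->
  (0 < lebesgue_cV R n U)%E.
Proof.
move=> oU [x Ux]; have /nbhs_ballP[e /= e0 eU] : nbhs x U by exact: open_nbhs_nbhs.
apply: (@lt_le_trans _ _ (lebesgue_cV R n (ball x e))).
  by rewrite lebesgue_cV_ball// lte_fin exprn_gt0// mulrn_wgt0.
apply: le_measure; rewrite ?inE//.
  exact: measurable_ball_cV.
exact: open_measurable_cV.
Qed.

End cV_borel.

Section translation.
Context {R : realType}.
Local Notation la := (@lebesgue_measure R).

Lemma lebesgue_measure_translate (a : R) (A : set (measurableTypeR R)) :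
  measurable A -> la ((fun t => a + t) @^-1` A) = la A.
Proof.
pose g : measurableTypeR R -> measurableTypeR R := fun t => a + t.
have mg : measurable_fun setT g by exact: measurable_funD.
move=> mA; apply/esym.
have := @lebesgue_measure_unique R (measure_function_pushforward__canonical__measure_function_Measure la mg).
apply => // _ [[c e]] _ <-.
rewrite /= /pushforward/=.
rewrite (_ : g @^-1` _ = `]c - a, e - a]%classic); last first.
  by apply/seteqP; split => t /=; rewrite !in_itv/= /g; lra.
rewrite !lebesgue_measure_itv/= !lte_fin ltrD2r.
by case: ifP => // _; rewrite -!EFinB; congr EFin; lra.
Qed.

Lemma cons_cVD n (t s : R) (x y : 'cV[R]_n) :
  cons_cV (t, x) + cons_cV (s, y) = cons_cV (t + s, x + y).
Proof.
apply/matrixP => i j; rewrite ord1 [LHS]mxE.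
by case: (unliftP ord0 i) => [k|] ->; rewrite ?cons_cV0 ?cons_cV_lift ?[RHS]mxE.
Qed.

(** By uniqueness of the product measure it suffices to compare the two measures on rectangles,
    where the first factor is the real line and the second is the induction hypothesis. *)
Lemma lebesgue_cV_translate n (a : 'cV[R]_n) (A : set 'cV[R]_n) :
  measurable A ->
  lebesgue_cV R n ((fun x => a + x) @^-1` A) = lebesgue_cV R n A.
Proof.
elim: n a A => [|n IH] a A mA.
  congr (lebesgue_cV R 0 _); apply/seteqP; split => x /=;
  by rewrite (_ : a + x = x)//; apply/matrixP => -[].
rewrite /= /lebesgue_cons /pushforward.
rewrite -(uncons_cVK a); case: (uncons_cV a) => t x.
pose g (z : measurableTypeR R * 'cV[R]_n) : measurableTypeR R * 'cV[R]_n :=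
  (t + z.1, x + z.2).
have mD : measurable_fun setT (fun z : 'cV[R]_n => x + z).
  apply: measurable_fun_matrix => i j; under eq_fun do rewrite mxE.
  by apply: measurable_funD => //; exact: measurable_matrix_entry.
have mg : measurable_fun setT g.
  apply/measurable_fun_pairP; split => /=.
    by apply: measurable_funD => //; exact: measurable_fst.
  exact: (measurableT_comp mD measurable_snd).
have -> : cons_cV (n:=n) @^-1` ((fun x0 => cons_cV (t, x) + x0) @^-1` A) =
    g @^-1` (cons_cV (n:=n) @^-1` A).
  by apply/funext => -[s y] /=; rewrite cons_cVD.
have mB : measurable (cons_cV (n:=n) @^-1` A).
  by rewrite -[X in measurable X]setTI; exact: measurable_cons_cV.
apply/esym; apply: (@product_measure_unique _ _ _ _ R la (lebesgue_cV R n)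
  (measure_function_pushforward__canonical__measure_function_Measure
    (la \x lebesgue_cV R n)%E mg)) => // B C mB' mC /=.
rewrite /pushforward (_ : g @^-1` _ =
  ((fun s => t + s) @^-1` B) `*` ((fun y => x + y) @^-1` C))//.
have mB1 : measurable ((fun s : measurableTypeR R => t + s) @^-1` B).
  by rewrite -[X in measurable X]setTI; exact: measurable_funD.
have mC1 : measurable ((fun y => x + y) @^-1` C).
  by rewrite -[X in measurable X]setTI; exact: mD.
rewrite product_measure1E//; congr (_ * _)%E; last exact: IH.
exact: lebesgue_measure_translate.
Qed.

End translation.

(** * Test functions *)

Section bounded_cV.
Context {R : realType}.

Lemma norm_trmx m n (M : 'M[R]_(m, n)) : `|M^T| = `|M|.
Proof.
apply/eqP; rewrite eq_le; apply/andP; split; apply: mx_norm_le => // i j.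
  by rewrite mxE coord_le_norm.
by have := coord_le_norm M^T j i; rewrite mxE.
Qed.

Lemma continuous_trmx m n : continuous (trmx : 'M[R]_(m, n) -> 'M[R]_(n, m)).
Proof.
move=> u A /nbhs_ballP[e /= e0 eA].
apply/nbhs_ballP; exists e => //= v [_ uv]; apply: eA; split => // i j.
by rewrite !mxE; exact: uv.
Qed.

Lemma continuous_bounded_ball n (f : 'cV[R]_n -> R) (x : 'cV[R]_n) (r : R) :
  0 < r -> continuous f -> [bounded f y | y in [set y : 'cV[R]_n | `|x - y| <= r]].
Proof.
(* Compactness of closed bounded sets is applied to row vectors, hence the transposition. *)
move=> r0 cf; pose A := [set v : 'rV[R]_n | `|x^T - v| <= r].
have cA : compact A.
  apply: bounded_closed_compact.
    exists (`|x^T| + r); split; first exact: num_real.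
    move=> M xrM v /= Av; rewrite (le_trans _ (ltW xrM))//.
    rewrite -[v](subKr x^T) (le_trans (ler_normB _ _))//.
    by rewrite lerD2l.
  have <- : closed_ball x^T r = A by rewrite closed_ballE.
  exact: closed_ball_closed.
have cfT : {within A, continuous (f \o trmx)}.
  apply: continuous_subspaceT => v; apply: continuous_comp; last exact: cf.
  exact: continuous_trmx.
have [M [Mr fM]] := compact_bounded (continuous_compact cfT cA).
exists M; split; first exact: num_real.
move=> N MN y /= xy; apply: (fM _ MN).
by exists y^T; rewrite /A/= ?trmxK// -linearB/= norm_trmx.
Qed.

End bounded_cV.

(** The building block of the test functions: [Num.max s 0 ^+ 2] is of class C^1 and positive
    exactly for [s > 0]. Its difference quotient of step [h] is within [|h|] of the derivative. *)
Lemma derivable_max0_sqr {R : realType} (t : R) :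
  is_derive t 1 (fun s : R => Num.max s 0 ^+ 2) (2 * Num.max t 0).
Proof.
pose F (s : R) := Num.max s 0 ^+ 2.
have key h : h != 0 -> `|2 * Num.max t 0 - h^-1 * (F (h + t) - F t)| <= `|h|.
  move=> h0; have hi : 0 < `|h| by rewrite normr_gt0.
  rewrite -(ler_pM2r hi) -normrM -expr2 real_normK ?num_real//.
  have -> : (2 * Num.max t 0 - h^-1 * (F (h + t) - F t)) * h =
      2 * Num.max t 0 * h - (F (h + t) - F t) by field.
  rewrite /F; case: (leP t 0) => t0; case: (leP (h + t) 0) => ht;
    rewrite ler_norml; apply/andP; split; nra.
have cv : h^-1 *: ((F \o shift t) (h *: 1) - F t) @[h --> 0^'] --> 2 * Num.max t 0.
  apply/cvgrPdist_lt => e e0; exists e => // h /=; rewrite sub0r normrN => he h0.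
  by rewrite [_ *: 1]mulr1; exact: le_lt_trans (key h h0) he.
by apply: DeriveDef; [apply/cvg_ex; eexists; exact: cv|exact: cvg_lim cv].
Qed.

Section C1_functions.
Context {R : realType} {V : normedModType R}.
Implicit Types (phi psi : V -> R) (x v : V).

Definition C1 phi :=
  (forall x, differentiable phi x) /\ (forall v, continuous ('D_v phi)).

Lemma C1_continuous phi : C1 phi -> continuous phi.
Proof. by move=> [dphi _] x; exact: differentiable_continuous. Qed.

Lemma C1_derivable phi x v : C1 phi -> derivable phi x v.
Proof. by move=> [dphi _]; exact: diff_derivable. Qed.

Lemma C1_cst (c : R) : C1 (cst c).
Proof.
split => [x|v]; first exact: differentiable_cst.
rewrite (_ : 'D_v _ = cst 0); first exact: cst_continuous.
by apply/funext => x; rewrite derive_cst.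
Qed.

Lemma C1M phi psi : C1 phi -> C1 psi -> C1 (fun x => phi x * psi x).
Proof.
move=> Cphi Cpsi; split => [x|v].
  by apply: differentiableM; [exact: Cphi.1|exact: Cpsi.1].
rewrite (_ : 'D_v _ = fun x => phi x * 'D_v psi x + psi x * 'D_v phi x).
  move=> x; apply: cvgD; apply: cvgM.
  - exact: C1_continuous.
  - exact: Cpsi.2.
  - exact: C1_continuous.
  - exact: Cphi.2.
apply/funext => x; rewrite (_ : (fun _ => _) = phi * psi)//.
by rewrite deriveM//; exact: C1_derivable.
Qed.

Lemma C1V phi : (forall x, 0 < phi x) -> C1 phi -> C1 (fun x => (phi x)^-1).
Proof.
move=> phi0 Cphi.
have phiN0 x : phi x != 0 by rewrite gt_eqF.
split => [x|v]; first by apply: differentiableV => //; exact: Cphi.1.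
rewrite (_ : 'D_v _ = fun x => - (phi x) ^- 2 * 'D_v phi x).
  move=> x; apply: cvgM; last exact: Cphi.2.
  apply: cvgN; apply: cvgV; first by rewrite expf_neq0.
  by apply: cvgM; exact: C1_continuous.
by apply/funext => x; rewrite deriveV//; exact: C1_derivable.
Qed.

Lemma C1D phi psi : C1 phi -> C1 psi -> C1 (fun x => phi x + psi x).
Proof.
move=> Cphi Cpsi; split => [x|v].
  by apply: differentiableD; [exact: Cphi.1|exact: Cpsi.1].
rewrite (_ : 'D_v _ = fun x => 'D_v phi x + 'D_v psi x).
  by move=> x; apply: cvgD; [exact: Cphi.2|exact: Cpsi.2].
apply/funext => x; rewrite (_ : (fun _ => _) = phi + psi)//.
by rewrite deriveD//; exact: C1_derivable.
Qed.

Lemma C1_prod (I : Type) (s : seq I) (phi : I -> V -> R) :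
  (forall i, C1 (phi i)) -> C1 (fun x => \prod_(i <- s) phi i x).
Proof.
move=> Cphi; elim: s => [|i s IH].
  rewrite (_ : (fun _ => _) = cst 1); first exact: C1_cst.
  by apply/funext => x; rewrite big_nil.
rewrite (_ : (fun _ => _) = fun x => phi i x * \prod_(j <- s) phi j x).
  exact: C1M.
by apply/funext => x; rewrite big_cons.
Qed.

Lemma C1_max0_sqr (phi : V -> R) : C1 phi ->
  C1 (fun x => Num.max (phi x) 0 ^+ 2).
Proof.
move=> Cphi.
have dm (t : R) : differentiable (fun s : R => Num.max s 0 ^+ 2) t.
  by apply/derivable1_diffP; have [] := derivable_max0_sqr t.
split => [x|v].
  by apply: (@differentiable_comp _ _ _ _ phi (fun s : R => Num.max s 0 ^+ 2)) => //; exact: Cphi.1.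
rewrite (_ : 'D_v _ = fun x => 2 * Num.max (phi x) 0 * 'D_v phi x).
  move=> x; apply: cvgM; last exact: Cphi.2.
  apply: cvgM; first exact: cvg_cst.
  have cm : continuous (fun t : R => Num.max t 0).
    move=> t; apply/cvgrPdist_lt => e e0; exists e => // s /=; apply: le_lt_trans.
    case: (leP t 0) => ?; case: (leP s 0) => ?; rewrite ler_norml;
    by have := ler_norm (t - s); have := ler_norm (- (t - s)); rewrite normrN; lra.
  by apply: (@continuous_comp _ _ _ phi (fun t : R => Num.max t 0)); [exact: C1_continuous|exact: cm].
apply/funext => x.
rewrite (_ : (fun _ => _) = (fun s : R => Num.max s 0 ^+ 2) \o phi)//.
rewrite deriveE; last by apply: differentiable_comp => //; exact: Cphi.1.
rewrite diff_comp//=; last exact: Cphi.1.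
rewrite -(deriveE v (Cphi.1 x)) diff1E// derive1E.
by have [_ ->] := derivable_max0_sqr (phi x); rewrite [LHS]mulrC.
Qed.

End C1_functions.

Section C1_cV.
Context {R : realType} {n : nat}.
Implicit Types (phi : 'cV[R]_n -> R) (x v : 'cV[R]_n).

Lemma derive_partialE phi x v : differentiable phi x ->
  'D_v phi x = \sum_(i < n) v i 0 * partial i phi x.
Proof.
move=> dphi; rewrite deriveE// [in LHS](matrix_sum_delta v) linear_sum.
apply: eq_bigr => i _; rewrite big_ord1 linearZ/=.
by rewrite /partial deriveE.
Qed.

Lemma C1_coord (i : 'I_n) : C1 (fun x => x i 0).
Proof.
split => [x|v]; first exact: differentiable_coord.
rewrite (_ : 'D_v _ = cst (v i 0)); first exact: cst_continuous.
apply/funext => x; rewrite deriveE; last exact: differentiable_coord.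
pose f := (fun N : 'cV[R]_n => N i 0 : R).
have lf : linear f by move=> a y z; rewrite /f !mxE.
pose L := GRing.isLinear.Build _ _ _ _ f lf.
pose F : {linear 'cV[R]_n -> R} := HB.pack f L.
have cF : continuous F.
  by move=> y; apply: differentiable_continuous; exact: differentiable_coord.
by have := @diff_lin _ _ _ F x cF; rewrite /= => ->.
Qed.

End C1_cV.

Lemma max0_sqr_gt0 (R : realDomainType) (t : R) :
  (0 < Num.max t 0 ^+ 2) = (0 < t).
Proof.
by case: (leP t 0) => t0; [rewrite expr0n/= ltxx|rewrite exprn_gt0].
Qed.

Lemma cvg_saturate (R : realType) (p : R) : 0 < p ->
  k%:R * p * (1 + k%:R * p)^-1 @[k --> \oo] --> (1 : R).
Proof.
move=> p0; apply/cvgrPdist_le => e e0.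
exists (Num.truncn (e^-1 / p)).+1 => // k /= Nk.
have kp0 : 0 <= k%:R * p by rewrite mulr_ge0// ltW.
have d0 : 0 < 1 + k%:R * p by rewrite ltr_pwDl.
have -> : 1 - k%:R * p * (1 + k%:R * p)^-1 = (1 + k%:R * p)^-1.
  by field; rewrite gt_eqF.
rewrite ger0_norm ?invr_ge0 ?(ltW d0)// invf_ple ?posrE//.
rewrite (@le_trans _ _ (k%:R * p)) ?lerDr// -ler_pdivrMr//.
by rewrite (le_trans (ltW (truncnS_gt _)))// ler_nat.
Qed.

Section bump.
Context {R : realType} {n : nat}.

(** For the supremum norm the ball is a cube, so a product over the coordinates of one-variable
    bumps, each positive exactly on its interval, does it. *)
Lemma C1_bump_ball (x0 : 'cV[R]_n) (r : R) : 0 < r ->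
  exists phi : 'cV[R]_n -> R, [/\ C1 phi, forall x, 0 <= phi x &
    forall x, 0 < phi x <-> ball x0 r x].
Proof.
move=> r0.
pose f (i : 'I_n) (x : 'cV[R]_n) :=
  Num.max (x i 0 + (r - x0 i 0)) 0 ^+ 2 * Num.max ((- 1) * x i 0 + (x0 i 0 + r)) 0 ^+ 2.
have f0 i x : 0 <= f i x by rewrite mulr_ge0// sqr_ge0.
exists (fun x => \prod_(i <- enum 'I_n) f i x); split.
- apply: C1_prod => i; apply: C1M; apply: C1_max0_sqr; apply: C1D.
  + exact: C1_coord.
  + exact: (C1_cst (r - x0 i 0)).
  + by apply: C1M; [exact: (C1_cst (- 1))|exact: C1_coord].
  + exact: (C1_cst (x0 i 0 + r)).
- by move=> x; apply: prodr_ge0.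
move=> x; rewrite ball_cVE//=.
have fE i : (0 < f i x) = (x i 0 \in `]x0 i 0 - r, x0 i 0 + r[).
  rewrite in_itv/= /f mulr_ge0_gt0 ?sqr_ge0// !max0_sqr_gt0.
  by apply/andP/andP => -[]; split; lra.
split=> [p0 i|xB].
  rewrite -fE lt0r f0 andbT; apply: contraTN isT => /eqP fi0.
  move: p0; rewrite (perm_big _ (perm_to_rem (mem_enum 'I_n i)))/= big_cons.
  by rewrite fi0 mul0r ltxx.
by apply: prodr_gt0 => i _; rewrite fE; exact: xB.
Qed.

End bump.

Section density.
Context {R : realType} {n : nat}.
Local Notation mu := (lebesgue_cV R n).

Let G : set (set 'cV[R]_n) := [set A | exists psi : 'cV[R]_n -> R,
  [/\ C1 psi, forall x, 0 <= psi x & A = [set x | 0 < psi x]]].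

Let C1_gt0_measurable (psi : 'cV[R]_n -> R) : C1 psi ->
  measurable [set x | 0 < psi x].
Proof.
move=> /C1_continuous cpsi; apply: open_measurable_cV.
rewrite (_ : [set _ | _] = psi @^-1` [set t | 0 < t])//.
by apply: open_comp => [x _|]; [exact: cpsi|exact: open_gt].
Qed.

Let G_setI : setI_closed G.
Proof.
move=> _ _ [f [Cf f0 ->]] [g [Cg g0 ->]].
exists (fun x => f x * g x); split; [exact: C1M|by move=> x; rewrite mulr_ge0|].
apply/seteqP; split => x /=; first by case=> *; rewrite mulr_gt0.
move=> fg; have fx : 0 < f x.
  by rewrite lt0r f0 andbT; apply: contraTN fg => /eqP ->; rewrite mul0r ltxx.
by split => //; rewrite pmulr_rgt0 in fg.
Qed.

(** The half-spaces where [x i 0 > a] belong to [G], through the square of the positive part of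
    [x i 0 - a], and they generate the sigma-algebra of each entry. *)
Let G_measurable : (@measurable _ 'cV[R]_n) `<=` <<s G >>.
Proof.
apply: smallest_sub; first exact: smallest_sigma_algebra.
move=> _ [i [j [B [mB ->]]]]; rewrite ord1.
have : measurable_fun setT (fun M : g_sigma_algebraType G => (M : 'cV[R]_n) i 0 : R).
  apply: (measurability _ (RGenOInfty.measurableE R)) => //.
  move=> _ [_ [a ->] <-]; rewrite setTI; apply: sub_sigma_algebra.
  exists (fun x => Num.max (x i 0 + (- a)) 0 ^+ 2); split.
  - apply: C1_max0_sqr; apply: C1D; first exact: C1_coord.
    exact: (C1_cst (- a)).
  - by move=> x; exact: sqr_ge0.
  apply/seteqP; split => x /=; rewrite in_itv/= andbT.
    by rewrite max0_sqr_gt0 subr_gt0.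
  by rewrite max0_sqr_gt0 subr_gt0.
by move=> /(_ measurableT B mB); rewrite setTI.
Qed.

(* phi0 confines the test functions to O: with p = phi0 psi, the functions
   k p / (1 + k p) tend to the indicator of O `&` [psi > 0], and the sets
   [psi > 0] form a pi-system generating the Borel sets. *)
Lemma ae_eq0_test_functions (O : set 'cV[R]_n) (phi0 h : 'cV[R]_n -> R) :
  measurable O -> C1 phi0 -> (forall x, 0 <= phi0 x) ->
  (forall x, 0 < phi0 x <-> O x) ->
  mu.-integrable O (EFin \o h) ->
  (forall phi, C1 phi -> (forall x, ~ O x -> phi x = 0) ->
    (\int[mu]_(x in O) (phi x * h x)%:E = 0)%E) ->
  {ae mu, forall x, O x -> h x = 0}.
Proof.
move=> mO Cphi0 phi0_ge0 phi0O ih H.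
have mh : measurable_fun O h by have /integrableP[/measurable_EFinP] := ih.
have cont_meas (f : 'cV[R]_n -> R) : continuous f -> measurable_fun O f.
  move=> cf; apply: measurable_funTS; apply: open_continuous_measurable_cV.
    exact: openT.
  by move=> x _; exact: cf.
have HG A : G A -> (\int[mu]_(x in O `&` A) (h x)%:E = 0)%E.
  move=> [psi [Cpsi psi0 ->{A}]].
  pose p x := phi0 x * psi x.
  have p0 x : 0 <= p x by rewrite mulr_ge0.
  have Cp : C1 p by exact: C1M.
  pose f k x := k%:R * p x * (1 + k%:R * p x)^-1.
  have den k x : 0 < 1 + k%:R * p x by rewrite ltr_pwDl// mulr_ge0.
  have Cf k : C1 (f k).
    apply: C1M; first by apply: C1M => //; exact: (C1_cst k%:R).
    apply: C1V => //; apply: C1D; first exact: (C1_cst 1).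
    by apply: C1M => //; exact: (C1_cst k%:R).
  have f01 k x : 0 <= f k x <= 1.
    rewrite divr_ge0 ?mulr_ge0//= ?(ltW (den _ _))//.
    by rewrite ler_pdivrMr// mul1r lerDr.
  have fO k x : ~ O x -> f k x = 0.
    move=> Ox; rewrite /f /p (_ : phi0 x = 0) ?(mul0r, mulr0)//.
    apply/eqP; rewrite eq_le phi0_ge0 andbT leNgt.
    by apply/negP => /phi0O.
  have mf k : measurable_fun O (fun x => (f k x * h x)%:E).
    apply/measurable_EFinP; apply: measurable_funM => //.
    by apply: cont_meas; exact: C1_continuous.
  rewrite integral_mkcondr.
  have mlim : measurable_fun O ((EFin \o h) \_ [set x | 0 < psi x]).
    have mpsi : measurable [set x | 0 < psi x] by exact: C1_gt0_measurable.
    apply/(measurable_restrict _ mpsi mO); apply/measurable_EFinP.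
    by apply: measurable_funS mh => //; exact: subIsetl.
  have flim : {ae mu, forall x, O x -> (f k x * h x)%:E @[k --> \oo] -->
      ((EFin \o h) \_ [set x | 0 < psi x]) x}.
    apply: aeW => x Ox; rewrite patchE; case: ifPn => [|].
      rewrite inE/= => psix.
      have px : 0 < p x by rewrite mulr_gt0//; exact/phi0O.
      apply: cvg_EFin; first exact: nearW.
      rewrite -[X in _ --> X]mul1r.
      exact: cvgM (cvg_saturate px) (cvg_cst (h x)).
    rewrite notin_setE/= => /negP; rewrite -leNgt => psix.
    have psix0 : psi x = 0 by apply/eqP; rewrite eq_le psix psi0.
    apply: cvg_near_cst; apply: nearW => k.
    by rewrite /f /p psix0 !(mulr0, mul0r).
  have fle : {ae mu, forall x k, O x -> (`|(f k x * h x)%:E| <= `|(h x)%:E|)%E}.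
    apply: aeW => x k _; rewrite lee_fin normrM ler_piMl//.
    by have /andP[f0 f1] := f01 k x; rewrite ger0_norm.
  have [_ _] := dominated_convergence mO mf mlim flim (integrable_abse ih) fle.
  move=> cv; apply: (cvg_unique _ cv) => //.
  by apply: cvg_near_cst; apply: nearW => k; apply: H => // x; exact: fO.
(* The sets over which [h] integrates to zero within [O] form a Dynkin system, so the pi-lambda
   theorem extends the vanishing from [G] to all measurable sets. *)
have HA A : measurable A -> (\int[mu]_(x in O `&` A) (h x)%:E = 0)%E.
  pose L := [set A : set 'cV[R]_n | measurable A /\
    (\int[mu]_(x in O `&` A) (h x)%:E = 0)%E].
  suff GL : <<s G >> `<=` L by move=> /G_measurable/GL[].
  rewrite -(setI_closed_g_dynkin_g_sigma_algebra G_setI).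
  have mG A' : G A' -> measurable A'.
    by move=> [psi [Cpsi _ ->]]; exact: C1_gt0_measurable.
  apply: smallest_sub; last by move=> A' GA; split; [exact: mG|exact: HG].
  have iO B : measurable B -> mu.-integrable (O `&` B) (EFin \o h).
    move=> mB; apply: integrableS ih => //; exact: measurableI.
  have GT : G setT.
    exists (cst 1); split; [exact: C1_cst|by []|].
    by apply/seteqP; split => x //= _; exact: ltr01.
  have h0 : (\int[mu]_(x in O) (h x)%:E = 0)%E by rewrite -(setIT O) HG.
  split.
  - by split; [exact: measurableT|exact: HG].
  - move=> A' [mA A0]; split; first exact: measurableC.
    have : (\int[mu]_(x in O `&` A' `|` O `&` ~` A') (h x)%:E = 0)%E.
      by rewrite -setIUr setUv setIT.
    rewrite integral_setU//=.
    + by rewrite A0 add0e.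
    + exact: measurableI.
    + by apply: measurableI => //; exact: measurableC.
    + by rewrite -setIUr setUv setIT; apply/measurable_EFinP.
    + apply/disj_set2P; by rewrite setIACA setICr setI0.
  move=> F tF LF; split; first by apply: bigcup_measurable => k _; exact: (LF k).1.
  rewrite setI_bigcupr integral_bigcup.
  - by rewrite eseries0// => k _ _; exact: (LF k).2.
  - by apply: trivIset_setIl.
  - by move=> k; apply: measurableI => //; exact: (LF k).1.
  - rewrite -setI_bigcupr; apply: iO.
    by apply: bigcup_measurable => k _; exact: (LF k).1.
have : ae_eq mu O (EFin \o h) (cst 0%E).
  apply: integral_ae_eq => // E EO mE.
  by rewrite integral0 -(setIidr EO); exact: HA.
by apply: filterS => x hx Ox; have := hx Ox => /= -[].
Qed.

End density.

Lemma integral_support d (T : measurableType d) (R : realType)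
    (mu : {measure set T -> \bar R}) (A B : set T) (f : T -> \bar R) :
  A `<=` B -> (forall x, B x -> ~ A x -> f x = 0%E) ->
  (\int[mu]_(x in B) f x = \int[mu]_(x in A) f x)%E.
Proof.
move=> AB f0; rewrite [LHS]integral_mkcond [RHS]integral_mkcond.
congr (integral _ _ _); apply/funext => x; rewrite !patchE.
case: ifPn; case: ifPn => //.
  by rewrite notin_setE inE => Ax Bx; exact: f0.
by rewrite inE notin_setE => /AB.
Qed.

Lemma integrable_support d (T : measurableType d) (R : realType)
    (mu : {measure set T -> \bar R}) (A : set T) (f : T -> \bar R) :
  measurable A -> (forall x, ~ A x -> f x = 0%E) ->
  mu.-integrable A f -> mu.-integrable setT f.
Proof.
move=> mA f0 /(integrable_mkcond _ mA) iA; apply: eq_integrable iA => // x _; rewrite patchE.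
by case: ifPn => //; rewrite notin_setE => /f0.
Qed.

Lemma integral_lebesgue_cV_translate (R : realType) n (a : 'cV[R]_n)
    (f : 'cV[R]_n -> \bar R) : measurable_fun setT f ->
  (\int[lebesgue_cV R n]_x f (a + x)%R = \int[lebesgue_cV R n]_x f x)%E.
Proof.
have mD : measurable_fun setT (fun z : 'cV[R]_n => a + z).
  apply: measurable_fun_matrix => i j; under eq_fun do rewrite mxE.
  by apply: measurable_funD => //; exact: measurable_matrix_entry.
have ge0 (g : 'cV[R]_n -> \bar R) : measurable_fun setT g -> (forall x, 0 <= g x)%E ->
    (\int[lebesgue_cV R n]_x g (a + x)%R = \int[lebesgue_cV R n]_x g x)%E.
  move=> mg g0.
  have := @ge0_integral_pushforward _ _ _ _ R _ mD (lebesgue_cV R n) setT g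
    measurableT mg (fun x _ => g0 x).
  rewrite preimage_setT => <-.
  apply: (@eq_measure_integral _ _ _ setT (lebesgue_cV R n)
    (measure_function_pushforward__canonical__measure_function_Measure
      (lebesgue_cV R n) mD)) => A mA _.
  exact: lebesgue_cV_translate.
move=> mf; rewrite integralE [RHS]integralE; congr (_ - _)%E.
  rewrite -(ge0 f^\+%E)//; [by apply: eq_integral => x _; rewrite funepos_comp|
    exact: measurable_funepos].
rewrite -(ge0 f^\-%E)//; [by apply: eq_integral => x _; rewrite funeneg_comp|
  exact: measurable_funeneg].
Qed.

(** The points of [O] where [h] is nonzero form an open set, and nonempty open sets have positive
    measure. *)
Lemma ae_continuous_eq0 (R : realType) n (O : set 'cV[R]_n) (h : 'cV[R]_n -> R) :
  open O -> {in O, continuous h} ->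
  {ae lebesgue_cV R n, forall x, O x -> h x = 0} -> forall x, O x -> h x = 0.
Proof.
move=> oO ch [N [mN N0 hN]] x Ox; apply: contrapT => /eqP hx.
pose U := O `&` [set y | h y != 0].
have oU : open U.
  rewrite openE => y [Oy hy]; apply: filterI; first exact: open_nbhs_nbhs.
  have oN0 : open [set t : R | t != 0] by exact: open_neq.
  have n0 : nbhs (h y) [set t : R | t != 0] by exact: open_nbhs_nbhs.
  exact: (ch y (mem_set Oy) _ n0).
have : (0 < lebesgue_cV R n U)%E by apply: lebesgue_cV_open_gt0 => //; exists x.
apply/negP; rewrite -leNgt -N0; apply: le_measure; rewrite ?inE//.
  exact: open_measurable_cV.
by move=> y [Oy /eqP hy]; apply: hN => /= /(_ Oy).
Qed.

(** The formal product v . grad u, built from partial derivatives alone. It is the directional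
    derivative wherever [u] is differentiable, but below [u] is only known to have partial
    derivatives. *)
Definition dgrad (R : realType) n (u : 'cV[R]_n -> R) (v x : 'cV[R]_n) : R :=
  \sum_(i < n) v i 0 * partial i u x.

Lemma C1_translate (R : realType) (V : normedModType R) (phi : V -> R) (a : V) :
  C1 phi -> C1 (fun x => phi (x + a)).
Proof.
move=> Cphi.
have ds (x : V) : differentiable (fun x : V => x + a) x.
  by apply: differentiableD; [exact: ex_diff|exact: differentiable_cst].
split => [x|w].
  exact: (@differentiable_comp _ _ _ _ (fun x : V => x + a) phi x (ds x) (Cphi.1 _)).
rewrite (_ : 'D_w _ = 'D_w phi \o (fun x => x + a)).
  move=> x; apply: continuous_comp; last exact: Cphi.2.
  exact: differentiable_continuous.
apply/funext => x; have gE (h : R) : h *: w + x + a = h *: w + (x + a) by rewrite addrA.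
exact: (derive_affineE phi gE).
Qed.

(** * Directional derivatives and translations *)

Section weak_gradient.
Context {R : realType} {n : nat}.
Local Notation mu := (lebesgue_cV R n).
Variables (u : 'cV[R]_n -> R) (x0 : 'cV[R]_n) (r M : R).
(** The radius leaves room for translations: test functions supported in the ball of radius [r],
    shifted by a vector of norm at most [r], vanish beyond [2 * r], hence near the boundary of
    [E]. *)
Let E : set 'cV[R]_n := ball x0 (3 * r).
Hypothesis r0 : 0 < r.
Hypothesis cu : {in E, continuous u}.
Hypothesis du : forall x i, E x -> derivable u x (delta_mx i 0).
Hypothesis uM : forall x, E x -> `|u x| <= M.
Hypothesis iu : forall i, mu.-integrable E (fun x => (partial i u x)%:E).

Local Notation g := (dgrad u).

Let oE : open E. Proof. exact: ball_open. Qed.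
Let mE : measurable E. Proof. exact: measurable_ball_cV. Qed.
Let mu_E : (mu E < +oo)%E. Proof. exact: lebesgue_cV_ball_lty. Qed.

Let mu_cont (f : 'cV[R]_n -> R) : continuous f -> measurable_fun E f.
Proof. by move=> cf; apply: open_continuous_measurable_cV => // x _; exact: cf. Qed.

Let bounded_cont (f : 'cV[R]_n -> R) : continuous f -> [bounded f x | x in E].
Proof.
move=> cf; have r3 : 0 < 3 * r by rewrite mulr_gt0.
have [B [Br fB]] := continuous_bounded_ball x0 r3 cf.
exists B; split => // N BN x Ex; apply: fB => //=; apply: ltW.
by move: Ex; rewrite /E -ball_normE.
Qed.

Let mu_u : measurable_fun E u. Proof. exact: open_continuous_measurable_cV. Qed.

Let bounded_u : [bounded u x | x in E].
Proof.
exists M; split; first exact: num_real.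
by move=> N MN x Ex; exact: (le_trans (uM Ex) (ltW MN)).
Qed.

Let iuC (f : 'cV[R]_n -> R) : continuous f ->
  mu.-integrable E (fun x => (u x * f x)%:E).
Proof.
move=> cf; have iu' : mu.-integrable E (EFin \o u).
  exact: measurable_bounded_integrable.
by have := integrableMl mE iu' (mu_cont cf) (bounded_cont cf).
Qed.

Let iCg (f : 'cV[R]_n -> R) v : continuous f ->
  mu.-integrable E (fun x => (f x * g v x)%:E).
Proof.
move=> cf.
have ig : mu.-integrable E (EFin \o g v).
  rewrite (_ : EFin \o g v =
      fun x => (\sum_(i < n) (v i 0)%:E * (partial i u x)%:E)%E); last first.
    by apply/funext => x; rewrite /= -sumEFin.
  by apply: integrable_sum => // i _; apply: integrableZl.
by have := integrableMr mE (mu_cont cf) (bounded_cont cf) ig.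
Qed.

Lemma weak_gradient (phi : 'cV[R]_n -> R) v : C1 phi ->
  (forall x, 2 * r < `|x0 - x| -> phi x = 0) ->
  \int[mu]_(x in E) (phi x * g v x) = - (\int[mu]_(x in E) (u x * 'D_v phi x)).
Proof.
move=> Cphi phi0.
(* The product has partial derivatives on the whole space: beyond distance [2 * r] it is locally
   zero, whatever [u] does outside [E]. Each of its partial derivatives therefore integrates to
   zero. *)
pose w x := phi x * u x.
have farN x : ~ E x -> 2 * r < `|x0 - x|.
  rewrite /E -ball_normE/= => /negP; rewrite -leNgt; apply: lt_le_trans.
  by rewrite ltr_pM2r// ltr_nat.
have near_far x : 2 * r < `|x0 - x| -> \forall y \near x, 2 * r < `|x0 - y|.
  move=> xr; have e0 : 0 < `|x0 - x| - 2 * r by rewrite subr_gt0.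
  apply/nbhs_ballP; exists (`|x0 - x| - 2 * r) => //= y; rewrite -ball_normE/= => xy.
  by have := ler_distD y x0 x; rewrite (distrC y x); lra.
have near_phi x : 2 * r < `|x0 - x| -> \forall y \near x, phi y = 0.
  by move=> /near_far; apply: filterS => y /phi0.
have Dphi0 v' x : 2 * r < `|x0 - x| -> 'D_v' phi x = 0.
  move=> xr; rewrite -(derive_cst (0 : R) x v'); apply: near_eq_derive => //.
  exact: near_phi.
have wfar x : 2 * r < `|x0 - x| -> {near x, cst 0 =1 w}.
  by move=> xr; apply: filterS (near_phi x xr) => y /= py; rewrite /w py mul0r.
have dw i x : derivable w x (delta_mx i 0).
  have [Ex|/farN xr] := pselect (E x).
    by apply: derivableM; [exact: C1_derivable|exact: du].
  exact: near_eq_derivable (wfar x xr) (derivable_cst _ _ _).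
have pw i x : partial i w x = phi x * partial i u x + u x * partial i phi x.
  have [Ex|/farN xr] := pselect (E x).
    by rewrite /partial -[w]/(phi * u) deriveM//; [exact: C1_derivable|exact: du].
  rewrite phi0// mul0r /partial Dphi0// mulr0 addr0.
  rewrite -(derive_cst (0 : R) x (delta_mx i 0)); apply: near_eq_derive => //.
  by apply: filterS (wfar x xr) => y ->.
have w0 (x : 'cV[R]_n) : `|x0| + 3 * r <= `|x| -> w x = 0.
  move=> xr; rewrite /w phi0 ?mul0r//.
  have h : `|x| - `|x0| <= `|x0 - x| by rewrite distrC lerB_dist.
  apply: lt_le_trans h; apply: (@lt_le_trans _ _ (3 * r)); last by rewrite lerBrDl.
  by rewrite ltr_pM2r// ltr_nat.
have idphi v' : mu.-integrable E (fun x => (u x * 'D_v' phi x)%:E).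
  by apply: iuC; exact: Cphi.2.
have iw i : mu.-integrable setT (fun x => (partial i w x)%:E).
  apply: (integrable_support mE) => [x Ex|].
    have xr := farN _ Ex.
    by rewrite pw phi0// /partial Dphi0// mul0r mulr0 addr0.
  have -> : (fun x => (partial i w x)%:E) =
      (fun x => (phi x * partial i u x)%:E + (u x * 'D_(delta_mx i 0) phi x)%:E)%E.
    by apply/funext => x; rewrite pw.
  apply: integrableD => //.
  have cphi := C1_continuous Cphi.
  exact: (integrableMr mE (mu_cont cphi) (bounded_cont cphi) (iu i)).
have E0 : (\int[mu]_(x in E) (phi x * g v x + u x * 'D_v phi x)%:E = 0)%E.
  transitivity (\int[mu]_x (\sum_(i < n) (v i 0)%:E * (partial i w x)%:E)%E)%E.
    apply/esym; rewrite (@integral_support _ _ _ mu E)//.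
      apply: eq_integral => x _; under eq_bigr do rewrite -EFinM.
      rewrite sumEFin; congr EFin.
      under eq_bigr do rewrite pw mulrDr.
      rewrite big_split/=; congr (_ + _).
        by rewrite /dgrad mulr_sumr; apply: eq_bigr => i _; rewrite mulrCA.
      rewrite derive_partialE; last exact: Cphi.1.
      by rewrite mulr_sumr; apply: eq_bigr => i _; rewrite mulrCA.
    move=> x _ Ex; rewrite big1// => i _; have xr := farN _ Ex.
    by rewrite pw phi0// /partial Dphi0// mul0r mulr0 addr0 mule0.
  rewrite integral_sum//; last by move=> i; apply: integrableZl.
  rewrite big1// => i _; rewrite integralZl//.
  by rewrite (integral_partial_eq0 (dw i) w0 (iw i)) mule0.
have D := RintegralD mE (iCg v (C1_continuous Cphi)) (idphi v).
by apply/eqP; rewrite -subr_eq0 opprK; apply/eqP; rewrite -D /Rintegral E0.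
Qed.

Let dE (x : 'cV[R]_n) : E x = (`|x0 - x| < 3 * r) :> Prop.
Proof. by rewrite /E -ball_normE. Qed.

Let O : set 'cV[R]_n := ball x0 r.

Let dO (x : 'cV[R]_n) : O x = (`|x0 - x| < r) :> Prop.
Proof. by rewrite /O -ball_normE. Qed.

Let shift_le (v : 'cV[R]_n) (e t : R) : e * `|v| <= r ->
  `]- e, e[%classic t -> `|t *: v| <= r.
Proof.
rewrite /= in_itv/= -ltr_norml => ev /ltW te; rewrite normrZ.
by rewrite (le_trans _ ev)// ler_wpM2r.
Qed.

Let shift_ball (v y : 'cV[R]_n) (e t : R) : e * `|v| <= r ->
  `]- e, e[%classic t -> O y -> E (y - t *: v).
Proof.
move=> ev te; rewrite dO dE => yr.
have -> : x0 - (y - t *: v) = (x0 - y) + t *: v by rewrite opprB addrCA addrC.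
rewrite (le_lt_trans (ler_normD _ _))//.
have -> : 3 * r = r + (r + r) by ring.
by rewrite ltr_leD// (le_trans (shift_le ev te))// lerDl ltW.
Qed.

Section line.
Variables (phi : 'cV[R]_n -> R) (v : 'cV[R]_n) (e : R).
Hypothesis Cphi : C1 phi.
Hypothesis phiO : forall x, ~ O x -> phi x = 0.
Hypothesis e0 : 0 < e.
Hypothesis ev : e * `|v| <= r.

Let psi (t : R) (x : 'cV[R]_n) := phi (x + t *: v).
Let Psi (t : R) := \int[mu]_(x in E) (u x * psi t x).

Let psi_derive (t : R) (x w : 'cV[R]_n) : 'D_w (psi t) x = 'D_w phi (x + t *: v).
Proof.
have gE (h : R) : h *: w + x + t *: v = h *: w + (x + t *: v) by rewrite addrA.
exact: (derive_affineE phi gE).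
Qed.

Let C1psi t : C1 (psi t).
Proof. exact: C1_translate. Qed.

Let psi0 t x : `]- e, e[%classic t -> 2 * r < `|x0 - x| -> psi t x = 0.
Proof.
move=> /(shift_le ev) tr xr; apply: phiO; rewrite dO opprD addrA; apply/negP; rewrite -leNgt.
have := lerB_dist (x0 - x) (t *: v) => h; rewrite (le_trans _ h)// lerBrDr.
by rewrite (le_trans (lerD (lexx _) tr))// ltW// -mulr2n -mulr_natl.
Qed.

Let psi_is_derive (t : R) x : is_derive t 1 (psi^~ x) ('D_v phi (x + t *: v)).
Proof.
have gE (h : R) : x + (h *: 1 + t) *: v = h *: v + (x + t *: v).
  by rewrite /GRing.scale/= mulr1 -/(GRing.scale _ _) scalerDl addrCA.
apply: DeriveDef; last exact: (derive_affineE phi gE).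
suff : derivable (phi \o (fun t : R => x + t *: v)) t 1 by [].
by rewrite (derivable_affineE phi gE); exact: C1_derivable.
Qed.

(** Only the test function depends on [t], so differentiation under the integral is dominated by a
    bound on [u] times one on the derivative of [phi]; [weak_gradient] then moves the derivative
    onto [u]. *)
Let Psi_is_derive (t : R) : `]- e, e[%classic t ->
  is_derive t 1 Psi (- \int[mu]_(x in E) (psi t x * g v x)).
Proof.
move=> te'.
have iup s : mu.-integrable E (EFin \o (fun x => u x * psi s x)).
  by apply: iuC; exact: C1_continuous.
have dup (s : R) (x : 'cV[R]_n) :
    is_derive s 1 (fun s => u x * psi s x) (u x * 'D_v phi (x + s *: v)).
  have d := psi_is_derive s x.
  exact: (is_deriveZ (u x) d).
(* A point of [E] is within [3 * r] of [x0] and the shift has norm at most [r], hence the radius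
   [4 * r]. *)
have [B [Br phiB]] : [bounded 'D_v phi x | x in [set x | `|x0 - x| <= 4 * r]].
  by apply: continuous_bounded_ball; [rewrite mulr_gt0|exact: Cphi.2].
(* Every number above [B] is a bound, hence [B + 1]; the maximum with 0 keeps the dominating
   constant nonnegative. *)
pose B' := Num.max (B + 1) 0.
have phiB' (s : R) (x : 'cV[R]_n) : `]- e, e[%classic s -> E x ->
    `|'D_v phi (x + s *: v)| <= B'.
  move=> /(shift_le ev) sr; rewrite dE => xr; rewrite le_max; apply/orP; left.
  apply: phiB; first by rewrite ltrDl.
  rewrite /= opprD addrA (le_trans (ler_normB _ _))//.
  have -> : 4 * r = 3 * r + r by ring.
  by rewrite lerD// ltW.
have part (s : R) (x : 'cV[R]_n) :
    partial1of2 (fun s x => u x * psi s x) s x = u x * 'D_v phi (x + s *: v).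
  by rewrite partial1of2E; have [] := dup s x.
have M0 : 0 <= Num.max M 0 * B' by rewrite mulr_ge0// le_max lexx orbT.
have [d1 d2] : derivable Psi t 1 /\ 'D_1 Psi t =
   \int[mu]_(x in E) (u x * 'D_v phi (x + t *: v)).
  have G1 : mu.-integrable E (EFin \o (fun _ : 'cV[R]_n => Num.max M 0 * B')).
    by apply: measurable_bounded_integrable => //; exact: bounded_cst.
  have G2 (s : R) (x : 'cV[R]_n) : `]- e, e[%classic s -> E x ->
      `|partial1of2 (fun s x => u x * psi s x) s x| <= Num.max M 0 * B'.
    move=> se Ex; rewrite part normrM ler_pM//; last exact: phiB'.
    by rewrite le_max uM.
  have dd (s : R) (x : 'cV[R]_n) : `]- e, e[%classic s -> E x ->
      derivable (fun s => u x * psi s x) s 1.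
    by move=> _ _; have [] := dup s x.
  split.
    exact: (derivable_under_integral mE te' (fun s _ => iup s) dd (fun=> M0) G1 G2).
  rewrite -derive1E.
  rewrite (differentiation_under_integral mE te' (fun s _ => iup s) dd (fun=> M0) G1 G2).
  by apply: eq_Rintegral => x _; rewrite part.
apply: DeriveDef => //; rewrite d2.
rewrite weak_gradient ?opprK; [|exact: C1psi|by move=> x; exact: psi0].
by apply: eq_Rintegral => x _; rewrite psi_derive.
Qed.

(** Translation invariance moves the shift from the test function to [u]. The integrand vanishes
    outside [O], so it may be integrated over the whole space, where the invariance applies. *)
Let Psi_translate (t : R) : `]- e, e[%classic t ->
  Psi t = \int[mu]_(x in O) (u (x - t *: v) * phi x).
Proof.
move=> te'; rewrite /Psi /Rintegral; congr fine.
pose f y : \bar R := (u (y - t *: v) * phi y)%:E.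
have Ef y : O y -> E (y - t *: v) by exact: (shift_ball ev te').
have f0 y : ~ O y -> f y = 0%E by move=> /phiO py; rewrite /f py mulr0.
have mf : measurable_fun setT f.
  have mO : measurable O by exact: measurable_ball_cV.
  rewrite (_ : f = f \_ O).
    apply/(measurable_restrictT _ mO)/measurable_EFinP.
    apply: open_continuous_measurable_cV; first exact: ball_open.
    move=> y; rewrite inE => Oy; apply: continuousM; last exact: C1_continuous.
    have /cu cuy : y - t *: v \in E by rewrite inE; exact: Ef.
    apply: (@continuous_comp _ _ _ (fun y : 'cV[R]_n => y - t *: v) u) => //.
    apply: differentiable_continuous.
    by apply: differentiableB; [exact: ex_diff|exact: differentiable_cst].
  apply/funext => y; rewrite patchE; case: ifPn => //.
  by rewrite notin_setE => /f0.
transitivity (\int[mu]_x f (t *: v + x)%R)%E.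
  transitivity (\int[mu]_(x in E) f (t *: v + x)%R)%E.
    by apply: eq_integral => x _; rewrite /f addrAC subrr add0r /psi addrC.
  apply/esym; apply: integral_support => // x _ Ex; apply: f0 => Ox; apply: Ex.
  by have := Ef _ Ox; rewrite addrAC subrr add0r.
rewrite integral_lebesgue_cV_translate//.
by apply: integral_support => // x _; exact: f0.
Qed.

Let Psi_constant (s1 s2 : R) : s1 <= s2 ->
  `]- e, e[%classic s1 -> `]- e, e[%classic s2 ->
  (forall t, `]- e, e[%classic t -> is_derive t 1 Psi 0) -> Psi s1 = Psi s2.
Proof.
move=> s12 s1e s2e dPsi.
have sub t : t \in `[s1, s2] -> `]- e, e[%classic t.
  move: s1e s2e; rewrite /= !in_itv/= => /andP[? ?] /andP[? ?] /andP[? ?].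
  by apply/andP; split; lra.
have dPsi' t : t \in `]s1, s2[ -> is_derive t 1 Psi (cst 0 t).
  by move=> ts; apply: dPsi; apply: sub; exact: subset_itv_oo_cc.
have cPsi : {within `[s1, s2], continuous Psi}.
  by apply: derivable_within_continuous => t /sub /dPsi[].
have [t _] := MVT_segment s12 dPsi' cPsi.
by rewrite /= mul0r => /eqP; rewrite subr_eq0 => /eqP.
Qed.

Let I0 : `]- e, e[%classic (0 : R).
Proof. by rewrite /= in_itv/= oppr_lt0 e0. Qed.

Lemma line_integral_constant t : `]- e, e[%classic t ->
  {ae mu, forall x, E x -> g v x = 0} ->
  \int[mu]_(x in O) (u (x - t *: v) * phi x) = \int[mu]_(x in O) (u x * phi x).
Proof.
move=> te' g0.
have dPsi s : `]- e, e[%classic s -> is_derive s 1 Psi 0.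
  move=> se; have := Psi_is_derive se.
  suff -> : \int[mu]_(x in E) (psi s x * g v x) = 0 by rewrite oppr0.
  rewrite /Rintegral (ae_eq_integral (cst 0%E)) ?integral0//.
    exact: measurable_int (iCg v (C1_continuous (C1psi s))).
  by apply: filterS g0 => x gx /gx ->; rewrite mulr0.
rewrite -(Psi_translate te').
have -> : \int[mu]_(x in O) (u x * phi x) = Psi 0.
  by rewrite (Psi_translate I0); apply: eq_Rintegral => x _; rewrite scale0r subr0.
have [t0|/ltW t0] := leP t 0; first exact: (Psi_constant t0).
exact/esym/(Psi_constant t0).
Qed.

(** Invariance of [u] makes [Psi] constant near 0, and its derivative there is minus the integral in
    question. *)
Lemma line_integral_derive0 :
  (forall t x, `]- e, e[%classic t -> O x -> u (x - t *: v) = u x) ->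
  (\int[mu]_(x in O) (phi x * g v x)%:E = 0)%E.
Proof.
move=> uc.
have PsiE t : `]- e, e[%classic t -> Psi t = \int[mu]_(x in O) (u x * phi x).
  move=> te'; rewrite (Psi_translate te'); apply: eq_Rintegral => x.
  by rewrite inE => Ox; rewrite uc.
have D0 : 'D_1 Psi 0 = 0.
  transitivity ('D_1 (cst (\int[mu]_(x in O) (u x * phi x) : R)) (0 : R)); last first.
    exact: derive_cst.
  apply: near_eq_derive; near=> t; apply: PsiE.
  by near: t; apply: near_in_itvoo; exact: I0.
have [_] := Psi_is_derive I0; rewrite D0 => /eqP; rewrite eq_sym oppr_eq0 => /eqP.
have psi00 : psi 0 = phi by apply/funext => x; rewrite /psi scale0r addr0.
rewrite psi00 => R0.
have i1 := iCg v (C1_continuous Cphi).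
rewrite -(@integral_support _ _ _ mu O E) => [|x|x _ Ox]; last by rewrite phiO// mul0r.
  by rewrite -[LHS]fineK ?integrable_fin_num// -/(Rintegral _ _ _) R0.
by rewrite dO dE => /lt_trans; apply; rewrite ltr_pMl// ltr1n.
Unshelve. all: by end_near. Qed.

End line.

(** The difference [u (x - t *: v) - u x] integrates to zero against every test function supported
    in [O], so it vanishes almost everywhere there, and everywhere by continuity. *)
Lemma constant_along (v : 'cV[R]_n) (e t : R) : 0 < e -> e * `|v| <= r ->
  `]- e, e[%classic t ->
  {ae mu, forall x, E x -> g v x = 0} ->
  forall x, O x -> u (x - t *: v) = u x.
Proof.
move=> e0 ev te' g0.
have OE x : O x -> E x.
  by rewrite dO dE => /lt_trans; apply; rewrite ltr_pMl// ltr1n.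
have OtE x : O x -> E (x - t *: v) by exact: (shift_ball ev te').
pose h x := u (x - t *: v) - u x.
have ch : {in O, continuous h}.
  move=> x; rewrite inE => Ox; apply: continuousB; last by apply: cu; rewrite inE; exact: OE.
  have /cu cuy : x - t *: v \in E by rewrite inE; exact: OtE.
  apply: (@continuous_comp _ _ _ (fun y : 'cV[R]_n => y - t *: v) u) => //.
  apply: differentiable_continuous.
  by apply: differentiableB; [exact: ex_diff|exact: differentiable_cst].
have mO : measurable O by exact: measurable_ball_cV.
have oO : open O by exact: ball_open.
have mh : measurable_fun O h by exact: open_continuous_measurable_cV.
have muO : (mu O < +oo)%E by exact: lebesgue_cV_ball_lty.
have bu (w : 'cV[R]_n -> 'cV[R]_n) : (forall x, O x -> E (w x)) ->
    [bounded u (w x) | x in O].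
  move=> wE; exists M; split; first exact: num_real.
  by move=> N MN x Ox; exact: (le_trans (uM (wE _ Ox)) (ltW MN)).
have mu1 : measurable_fun O u by apply: measurable_funS mu_u.
have i1 : mu.-integrable O (EFin \o u).
  exact: (measurable_bounded_integrable mO muO mu1 (bu id OE)).
have mu2 : measurable_fun O (fun x => u (x - t *: v)).
  rewrite (_ : (fun _ => _) = fun x => h x + u x); first exact: measurable_funD.
  by apply/funext => x; rewrite /h subrK.
have i2 : mu.-integrable O (EFin \o (fun x => u (x - t *: v))).
  exact: (measurable_bounded_integrable mO muO mu2 (bu _ OtE)).
have ih : mu.-integrable O (EFin \o h).
  exact: (integrableB mO i2 i1).
suff hae : {ae mu, forall x, O x -> h x = 0}.
  by move=> x Ox; have /eqP := ae_continuous_eq0 oO ch hae Ox; rewrite subr_eq0 => /eqP.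
have [phi0 [Cphi0 phi0_ge0 phi0O]] := C1_bump_ball x0 r0.
apply: (ae_eq0_test_functions mO Cphi0 phi0_ge0 phi0O ih) => phi Cphi phiO.
have bphi : [bounded phi x | x in O].
  have [B [Br pB]] := bounded_cont (C1_continuous Cphi).
  by exists B; split => // N BN x /OE; exact: pB.
have mphi : measurable_fun O phi.
  by apply: measurable_funS (mu_cont (C1_continuous Cphi)).
have j1 := integrableMl mO i1 mphi bphi.
have j2 := integrableMl mO i2 mphi bphi.
have := line_integral_constant Cphi phiO e0 ev te' g0.
move=> /eqP; rewrite -subr_eq0 -RintegralB// => /eqP H0.
have j3 := integrableB mO j2 j1.
rewrite (_ : (\int[mu]_(x in O) (phi x * h x)%:E)%E =
  (\int[mu]_(x in O) (u (x - t *: v) * phi x - u x * phi x)%:E)%E); last first.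
  by apply: eq_integral => x _; rewrite -mulrBl mulrC.
rewrite -[LHS]fineK; last exact: (integrable_fin_num mO j3).
by rewrite -/(Rintegral _ _ _) H0.
Qed.

Lemma dgrad_ae0 (v : 'cV[R]_n) (e : R) : 0 < e -> e * `|v| <= r ->
  (forall t x, `]- e, e[%classic t -> O x -> E (x - t *: v) ->
    u (x - t *: v) = u x) ->
  {ae mu, forall x, O x -> g v x = 0}.
Proof.
move=> e0 ev uc.
have OE x : O x -> E x.
  by rewrite dO dE => /lt_trans; apply; rewrite ltr_pMl// ltr1n.
have mO : measurable O by exact: measurable_ball_cV.
have ig : mu.-integrable O (EFin \o g v).
  have := iCg v (fun x => @cst_continuous _ _ (1 : R) x).
  move=> /(integrableS mE mO OE); apply: eq_integrable => // x _.
  by rewrite /= mul1r.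
have [phi0 [Cphi0 phi0_ge0 phi0O]] := C1_bump_ball x0 r0.
apply: (ae_eq0_test_functions mO Cphi0 phi0_ge0 phi0O ig) => phi Cphi phiO.
apply: (line_integral_derive0 Cphi phiO e0 ev) => t x te Ox.
exact: (uc _ _ te Ox (shift_ball ev te Ox)).
Qed.

End weak_gradient.

Lemma convex_segment (R : realType) (V : lmodType R) (D : set V) (x v : V) (t : R) :
  convex_set D -> D x -> D (x + v) -> 0 <= t <= 1 -> D (x + t *: v).
Proof.
move=> cD Dx Dxv /andP[t0 t1].
have := cD (x + v) x (Itv01 t0 t1); rewrite !inE => /(_ Dxv Dx).
congr D; rewrite /conv/= scalerDr addrAC -scalerDl.
by rewrite /unstable.onem addrCA subrr addr0 scale1r.
Qed.

Section ae_local.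
Context {R : realType} {n : nat}.
Local Notation mu := (lebesgue_cV R n).

(** A Lindelof argument: there are countably many balls with rational centre and radius
    [k.+1%:R^-1], and those on which [P] holds almost everywhere cover [D]. The enumeration [Q] is
    vacuous on the other balls. *)
Lemma ae_local (D : set 'cV[R]_n) (P : 'cV[R]_n -> Prop) :
  (forall x, D x -> exists2 r, 0 < r & {ae mu, forall y, ball x r y -> P y}) ->
  {ae mu, forall y, D y -> P y}.
Proof.
move=> loc.
pose B (qk : 'cV[rat]_n * nat) : set 'cV[R]_n :=
  ball (map_mx ratr qk.1 : 'cV[R]_n) (qk.2.+1%:R^-1).
pose Q (m : nat) (y : 'cV[R]_n) := forall qk, unpickle m = Some qk ->
  {ae mu, forall y, B qk y -> P y} -> B qk y -> P y.
have : {ae mu, forall y m, Q m y}.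
  apply: ae_foralln => m; rewrite /Q.
  case: (unpickle m) => [qk|]; last by apply: aeW.
  have [aeB|naeB] := pselect {ae mu, forall y, B qk y -> P y}.
    by apply: filterS aeB => y By _ [<-].
  by apply: aeW => y _ [<-].
apply: filterS => y Qy Dy.
have [e e0 ae_e] := loc y Dy.
pose k := Num.truncn (2 / e).
have k0 : (0 : R) < k.+1%:R^-1 by rewrite invr_gt0.
have ke : k.+1%:R^-1 < e / 2.
  by rewrite -[e / 2]invrK invf_div ltf_pV2 ?posrE ?divr_gt0// truncnS_gt.
have [q yq] := rat_ball_cV y k0.
apply: (Qy (pickle (q, k)) (q, k)); first by rewrite pickleK.
  apply: filterS ae_e => z Pz Bz; apply: Pz.
  by apply: (@ball_split _ _ (map_mx ratr q : 'cV[R]_n));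
    [apply: le_ball yq|apply: le_ball Bz]; exact: ltW.
exact: ball_sym.
Qed.

End ae_local.

(** * From small balls to the open set D *)

Section directional.
Context {R : realType} {n : nat}.
Local Notation mu := (lebesgue_cV R n).
Variables (D : set 'cV[R]_n) (u : 'cV[R]_n -> R) (v : 'cV[R]_n).
Hypothesis oD : open D.
Hypothesis cu : {in D, continuous u}.
Hypothesis du : forall x i, D x -> derivable u x (delta_mx i 0).
Hypothesis iu : forall x, D x -> exists2 r, 0 < r &
  forall i, mu.-integrable (ball x r) (fun y => (partial i u y)%:E).

Let local_data x : D x -> exists r M, [/\ 0 < r, ball x (3 * r) `<=` D,
  forall y, ball x (3 * r) y -> `|u y| <= M &
  forall i, mu.-integrable (ball x (3 * r)) (fun y => (partial i u y)%:E)].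
Proof.
move=> Dx; have [r1 r10 ir] := iu Dx.
have /nbhs_ballP[r2 /= r20 r2D] : nbhs x D by exact: open_nbhs_nbhs.
have /cvgrPdist_le/(_ 1 ltr01)/nbhs_ballP[r3 /= r30 r3u] := cu (mem_set Dx).
pose r := Num.min r1 (Num.min r2 r3) / 3.
have r0 : 0 < r by rewrite divr_gt0// !lt_min r10 r20.
have r3E : 3 * r = Num.min r1 (Num.min r2 r3) by rewrite mulrC divfK.
have [l1 l2 l3] : [/\ 3 * r <= r1, 3 * r <= r2 & 3 * r <= r3].
  by rewrite r3E; split; rewrite !ge_min lexx ?orbT.
exists r, (`|u x| + 1); split => // [y|y|i].
- by move=> xy; apply: r2D; exact: le_ball xy.
- move=> xy; have := r3u y (le_ball l3 xy) => /= uxy.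
  rewrite -[u y](subKr (u x)) (le_trans (ler_normB _ _))//.
  by rewrite lerD2l.
- apply: integrableS (ir i); [exact: measurable_ball_cV|exact: measurable_ball_cV|].
  by move=> y; exact: le_ball.
Qed.

(** An admissible step for [constant_along] and [dgrad_ae0]; the [+ 1] covers [v = 0]. *)
Let small (r : R) : 0 < r -> 0 < r / (`|v| + 1) /\ r / (`|v| + 1) * `|v| <= r.
Proof.
move=> r0; have v1 : 0 < `|v| + 1 by rewrite ltr_wpDl.
split; first by rewrite divr_gt0.
by rewrite mulrAC ler_pdivrMr// ler_wpM2l ?ltW// ltrDl.
Qed.

(** By convexity the segment stays in [D]. Around each of its points [u] is locally constant along
    [v], so [f] has zero derivative on [[0, 1]] and the mean value theorem concludes. *)
Lemma dgrad_eq0_constant : convex_set D ->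
  {ae mu, forall x, D x -> dgrad u v x = 0} ->
  forall x, D x -> D (x + v) -> u (x + v) = u x.
Proof.
move=> cD g0 x Dx Dxv.
pose f (t : R) := u (x + t *: v).
have df (t : R) : 0 <= t <= 1 -> is_derive t 1 f (cst 0 t).
  move=> t01; have Dt := convex_segment cD Dx Dxv t01.
  have [r [M [r0 rD uM ir]]] := local_data Dt.
  have [e0 ev] := small r0.
  have nearf : \forall s \near t, cst (f t) s = f s.
    apply/nbhs_ballP; exists (r / (`|v| + 1)) => //= s; rewrite -ball_normE /= => ts.
    have ts' : `]- (r / (`|v| + 1)), r / (`|v| + 1)[%classic (t - s).
      by rewrite /= in_itv/= -ltr_norml.
    have cu' : {in ball (x + t *: v) (3 * r) : set 'cV[R]_n, continuous u}.
      by move=> y; rewrite inE => /rD Dy; apply: cu; rewrite inE.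
    have du' y i : ball (x + t *: v) (3 * r) y -> derivable u y (delta_mx i 0).
      by move=> /rD; exact: du.
    have g0' : {ae mu, forall y, ball (x + t *: v) (3 * r) y -> dgrad u v y = 0}.
      by apply: filterS g0 => y gy /rD.
    have := constant_along r0 cu' du' uM ir e0 ev ts' g0' (ballxx _ r0).
    by rewrite /f -addrA -scalerBl subKr => ->.
  exact: (near_eq_is_derive nearf (is_derive_cst (f t) t 1)).
have cf : {within `[0, 1], continuous f}.
  by apply: derivable_within_continuous => t; rewrite in_itv/= => /df[].
have df' (t : R) : t \in `]0, 1[ -> is_derive t 1 f (cst 0 t).
  by move=> /subset_itv_oo_cc; rewrite in_itv/=; exact: df.
have [c _] := MVT_segment ler01 df' cf.
by rewrite /f /= mul0r scale1r scale0r addr0 => /eqP; rewrite subr_eq0 => /eqP.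
Qed.

Lemma constant_dgrad_eq0 :
  (forall x t, D x -> D (x + t *: v) -> u (x + t *: v) = u x) ->
  {ae mu, forall x, D x -> dgrad u v x = 0}.
Proof.
move=> uc; apply: ae_local => x Dx.
have [r [M [r0 rD uM ir]]] := local_data Dx.
have [e0 ev] := small r0.
exists r => //.
have cu' : {in ball x (3 * r) : set 'cV[R]_n, continuous u}.
  by move=> y; rewrite inE => /rD Dy; apply: cu; rewrite inE.
have du' y i : ball x (3 * r) y -> derivable u y (delta_mx i 0).
  by move=> /rD; exact: du.
apply: (dgrad_ae0 r0 cu' du' uM ir e0 ev).
move=> t y te Oy Ey.
have Dy : D y by apply: rD; apply: le_ball Oy; rewrite ler_pMl// ler1n.
by rewrite -scaleNr uc// scaleNr; exact: rD.
Qed.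

End directional.

(** * Transfer between the law of X and Lebesgue measure *)

Section density_transfer.
Context {d} {T : measurableType d} {R : realType} (P : probability T R).
Variables (p : nat) (X : {RV P >-> 'cV[R]_p}) (f : 'cV[R]_p -> R).
Hypothesis fX : is_density X f.
Local Notation mu := (lebesgue_cV R p).
Let D := [set x : 'cV[R]_p | 0 < f x].

Let mf : measurable_fun setT f. Proof. by have [] := fX. Qed.

Lemma measurable_density_support : measurable D.
Proof.
have : measurable (setT `&` f @^-1` `]0, +oo[) by apply: mf => //; exact: measurable_itv.
rewrite setTI.
by rewrite (_ : _ @^-1` _ = D)//; apply/seteqP; split => x /=; rewrite in_itv/= andbT.
Qed.

Let measurable_preX (A : set 'cV[R]_p) : measurable A -> measurable (X @^-1` A).
Proof. by move=> mA; rewrite -[X in measurable X]setTI; exact: measurable_funPT. Qed.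

Lemma density_support_full : P (X @^-1` (~` D)) = 0%E.
Proof.
have [_ f0 fA] := fX; have mD := measurable_density_support.
rewrite -[LHS]/(distribution P X (~` D)) fA; last exact: measurableC.
apply: integral0_eq => x /= /negP; rewrite -leNgt => fx0.
by congr EFin; apply/eqP; rewrite eq_le fx0 f0.
Qed.

(** On [D] the density is positive, so its integral over [N] vanishes only if [N] is null: there the
    two measures have the same null sets. *)
Lemma density_null (N : set 'cV[R]_p) : measurable N -> N `<=` D ->
  P (X @^-1` N) = 0%E <-> mu N = 0%E.
Proof.
have [_ f0 fA] := fX; move=> mN ND.
rewrite -[P _]/(distribution P X N) fA//.
have mfN : measurable_fun N (EFin \o f).
  by apply/measurable_EFinP; exact: measurable_funTS.
split => [I0|N0]; last exact: null_set_integral.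
have I1 : (\int[mu]_(x in N) `|(EFin \o f) x| = 0)%E.
  by rewrite -[RHS]I0; apply: eq_integral => x _; rewrite gee0_abs// lee_fin.
have ae0 := (ae_eq_integral_abs mu mN mfN).1 I1.
apply: measure_negligible => //; apply: negligibleS ae0 => x Nx /= /(_ Nx)[] fx0.
by have := ND x Nx; rewrite /D/= fx0 ltxx.
Qed.

(** The exceptional set of an almost sure statement lives in [T]; measurability of the failure set
    inside [D] allows its mass under the law of [X] to be compared with its Lebesgue measure. *)
Lemma ae_density_lebesgue (H : 'cV[R]_p -> Prop) :
  measurable (D `&` [set x | ~ H x]) ->
  {ae P, forall w, H (X w)} -> {ae mu, forall x, D x -> H x}.
Proof.
move=> mN aeH; set N := D `&` _ in mN.
have PN : P (X @^-1` N) = 0%E.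
  apply: measure_negligible; first exact: measurable_preX.
  by apply: negligibleS aeH => w [].
have [_ ND] := density_null mN (@subIsetl _ _ _).
exists N; split => //; first exact/(density_null mN (@subIsetl _ _ _)).
by move=> x /= /not_implyP.
Qed.

Lemma ae_lebesgue_density (H : 'cV[R]_p -> Prop) :
  {ae mu, forall x, D x -> H x} -> {ae P, forall w, H (X w)}.
Proof.
move=> [N [mN N0 HN]].
have mD := measurable_density_support.
have mND : measurable (N `&` D) by exact: measurableI.
exists (X @^-1` (N `&` D) `|` X @^-1` (~` D)); split.
- by apply: measurableU; apply: measurable_preX => //; exact: measurableC.
- apply/eqP; rewrite eq_le measure_ge0 andbT.
  apply: (@le_trans _ _ (P (X @^-1` (N `&` D)) + P (X @^-1` (~` D)))%E).
    by apply: measureU2; apply: measurable_preX => //; exact: measurableC.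
  rewrite density_support_full adde0.
  have /(density_null mND (@subIsetr _ _ _))-> // : mu (N `&` D) = 0%E.
  by apply/eqP; rewrite eq_le measure_ge0 andbT -N0 le_measure ?inE//; exact: subIsetl.
move=> w /= Hw; have [Dw|Dw] := pselect (D (X w)); [left|by right].
by split => //; apply: HN => /= /(_ Dw).
Qed.

Lemma density_support_nonempty : D !=set0.
Proof.
apply/set0P/eqP => D0; have := density_support_full.
by rewrite D0 setC0 preimage_setT probability_setT => /eqP; rewrite onee_eq0.
Qed.

Hypothesis oD : open D.
Hypothesis cf : {in D, continuous f}.

(** By continuity [f >= f x0 / 2] on a small ball, so there Lebesgue measure is at most a constant
    times the law of [X] and [h ^+ 2] is integrable for it. Integrability of [h] follows from
    [|h| <= 1 + h ^+ 2], the ball having finite measure. *)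
Lemma sqr_integrable_near (h : 'cV[R]_p -> R) x0 : D x0 ->
  measurable_fun D h ->
  P.-integrable setT (fun w => (h (X w) ^+ 2)%:E) ->
  exists2 r, 0 < r & mu.-integrable (ball x0 r) (EFin \o h).
Proof.
move=> Dx0 mh ih; have [_ f0 fA] := fX.
pose c := f x0 / 2; have c0 : 0 < c by rewrite divr_gt0.
have /nbhs_ballP[r1 /= r10 r1D] : nbhs x0 D by exact: open_nbhs_nbhs.
have /cvgrPdist_le/(_ c c0)/nbhs_ballP[r2 /= r20 r2f] := cf (mem_set Dx0).
pose r := Num.min r1 r2; have r0 : 0 < r by rewrite lt_min r10.
exists r => //; pose B : set 'cV[R]_p := ball x0 r; rewrite -/B.
have mB : measurable B by exact: measurable_ball_cV.
have BD : B `<=` D by move=> x xB; apply: r1D; apply: le_ball xB; rewrite ge_min lexx.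
have Bf x : B x -> c <= f x.
  move=> xB; have : ball x0 r2 x by apply: le_ball xB; rewrite ge_min lexx orbT.
  move=> /r2f /=; rewrite ler_norml /c => /andP[]; lra.
have mhB : measurable_fun B h by exact: (measurable_funS measurable_density_support BD mh).
have mh2B : measurable_fun B (fun x => (h x ^+ 2)%:E).
  by apply/measurable_EFinP; exact: measurable_funX.
pose H := (fun x => (h x ^+ 2)%:E) \_ B.
have mH : measurable_fun setT H by exact/(measurable_restrictT _ mB).
have H0 x : (0 <= H x)%E.
  by rewrite /H patchE; case: ifP => // _; rewrite lee_fin sqr_ge0.
pose nc : {nonneg R} := NngNum (ltW c0).
have m12 (S : set 'cV[R]_p) : measurable S ->
    (mscale nc (mrestr mu mB) S <= distribution P X S)%E.
  move=> mS; rewrite /mscale/= /mrestr.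
  apply: (@le_trans _ _ (distribution P X (S `&` B))); last first.
    by apply: le_measure; [rewrite inE; exact: measurableI|rewrite inE|exact: subIsetl].
  rewrite fA; last exact: measurableI.
  rewrite -integral_cst; last exact: measurableI.
  apply: ge0_le_integral => //.
  - exact: measurableI.
  - by move=> x _; rewrite lee_fin ltW.
  - by apply/measurable_EFinP; exact: measurable_funTS.
  - by move=> x [_ Bx]; rewrite lee_fin; exact: Bf.
have le1 := @ge0_le_measure_integral _ _ R
  (mscale nc (mrestr mu mB)) (distribution P X) m12 H B mB H0 mH.
have Pfin : (\int[distribution P X]_(x in B) H x < +oo)%E.
  apply: (@le_lt_trans _ _ (\int[distribution P X]_x H x)%E).
    exact: ge0_subset_integral.
  rewrite ge0_integral_distribution//.
  have /integrableP[_] := ih; apply: le_lt_trans.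
  apply: ge0_le_integral => //.
  - by move=> w _; exact: H0.
  - by apply: measurableT_comp mH _; exact: measurable_funPT.
  - by apply: measurableT_comp => //; exact: measurable_int ih.
  - move=> w _ /=; rewrite /H patchE; case: ifP => _.
      by rewrite lee_fin ler_norm.
    by rewrite lee_fin.
have h2fin : (\int[mu]_(x in B) (h x ^+ 2)%:E < +oo)%E.
  have := le_lt_trans le1 Pfin.
  rewrite ge0_integral_mscale//; last by apply: measurable_funTS.
  rewrite (@eq_measure_integral _ _ _ B mu) => [|A mA AB]; last first.
    by rewrite /= /mrestr setIidl.
  have -> : (\int[mu]_(x in B) H x = \int[mu]_(x in B) (h x ^+ 2)%:E)%E.
    by apply: eq_integral => x xB; rewrite /H patchE xB.
  have : (0 <= \int[mu]_(x in B) (h x ^+ 2)%:E)%E.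
    by apply: integral_ge0 => x _; rewrite lee_fin sqr_ge0.
  case: (\int[mu]_(x in B) (h x ^+ 2)%:E)%E => [s _ _| _|//]; first exact: ltry.
  by rewrite gt0_muley ?lte_fin.
apply/integrableP; split; first exact/measurable_EFinP.
apply: (@le_lt_trans _ _ (\int[mu]_(x in B) (1%:E + (h x ^+ 2)%:E))%E).
  apply: ge0_le_integral => //.
  - by apply: measurableT_comp => //; exact/measurable_EFinP.
  - by apply: emeasurable_funD.
  - move=> x _; rewrite /= lee_fin -(@real_normK _ (h x)) ?num_real//.
    by have := sqr_ge0 (`|h x| - 1); have := normr_ge0 (h x); nra.
rewrite ge0_integralD//; last by move=> x _; rewrite lee_fin sqr_ge0.
rewrite integral_cst//= mul1e lte_add_pinfty//.
exact: lebesgue_cV_ball_lty.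
Qed.

End density_transfer.

Lemma cvg_harmonic_scale (R : realType) (V : normedModType R) (v x : V) :
  k.+1%:R^-1 *: v + x @[k --> \oo] --> x.
Proof.
rewrite -[X in _ --> X]add0r -[X in _ --> X + _](scale0r v).
apply: cvgD; last exact: cvg_cst.
by apply: cvgZr_tmp; exact: cvg_harmonic.
Qed.

(** The partial derivative is the pointwise limit of the difference quotients with steps
    [k.+1%:R^-1]. *)
Lemma measurable_partial (R : realType) n (D : set 'cV[R]_n)
    (u : 'cV[R]_n -> R) (i : 'I_n) :
  open D -> {in D, continuous u} ->
  (forall x, D x -> derivable u x (delta_mx i 0)) ->
  measurable_fun D (partial i u).
Proof.
move=> oD cu du; have mD : measurable D by exact: open_measurable_cV.
have muD : measurable_fun D u by exact: open_continuous_measurable_cV.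
pose a (k : nat) : 'cV[R]_n := k.+1%:R^-1 *: delta_mx i 0.
(* Extension by zero, since [a k + x] may leave [D] for small [k]; for large [k] it stays in [D],
   which is open. *)
pose ut := u \_ D.
have mut : measurable_fun setT ut by exact/(measurable_restrictT _ mD).
have mut' k : measurable_fun setT (fun x => ut (a k + x)).
  apply: measurableT_comp => //.
  apply: measurable_fun_matrix => i' j; under eq_fun do rewrite mxE.
  by apply: measurable_funD => //; exact: measurable_matrix_entry.
apply: (@measurable_fun_cvg _ _ _ _
    (fun k x => k.+1%:R * (ut (a k + x) - ut x))).
  move=> k; apply: measurable_funTS; apply: measurable_funM => //.
  exact: measurable_funB.
move=> x Dx.
have cvgx := du x Dx.
have h0 : k.+1%:R^-1 @[k --> \oo] --> (0 : R) by exact: cvg_harmonic.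
have := (cvgr_dnbhsP _ _ _).1 cvgx (fun k => k.+1%:R^-1).
move=> /(_ (conj _ h0)) => cv.
have aE k : k.+1%:R^-1 *: delta_mx i 0 + x = a k + x by [].
have near_D : \forall k \near \oo, D (a k + x).
  have a0 : a k + x @[k --> \oo] --> x by exact: cvg_harmonic_scale.
  by apply: a0; exact: open_nbhs_nbhs.
apply: cvg_trans; last apply: cv; last by move=> k; rewrite invr_neq0.
apply: near_eq_cvg; apply: filterS near_D => k Dk.
by rewrite invrK /ut !patchE !mem_set.
Qed.

(** * The kernel of the composite matrix *)

Section copg_kernel.
Context {d} {T : measurableType d} {R : realType} (P : probability T R).
Variables (p : nat) (X : T -> 'cV[R]_p) (Q : R -> 'cV[R]_p -> R).
Hypothesis finS : copg_finite P X Q.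
Local Notation mu := (@lebesgue_measure R).
Local Notation S := (copg P X Q).
Implicit Type c : 'I_p -> 'I_p -> R.

Let I01 : set (measurableTypeR R) := `]0, 1[.

Let aemu : Filter (nbhs (almost_everywhere mu)).
Proof. exact: ae_filter_ringOfSetsType. Qed.

Let mI01 : measurable I01.
Proof. exact: measurable_itv. Qed.

(** A linear functional of the expected outer product, with coefficients [c]. It serves twice:
    coefficients [v i 0 * v j 0] give the quadratic form of [v], and coefficients supported on one
    row give one entry of the product with [v]. *)
Let Phi c (tau : R) : \bar R :=
  (\sum_(k : 'I_p * 'I_p)
     (c k.1 k.2)%:E * 'E_P[fun w => opg X Q tau w k.1 k.2])%E.

Let iPhi c : mu.-integrable I01 (Phi c).
Proof.
apply: integrable_sum => // k _; apply: integrableZl => //.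
exact: (finS _ _).2.
Qed.

Let int_Phi c :
  (\int[mu]_(tau in I01) Phi c tau = (\sum_i \sum_j c i j * S i j)%:E)%E.
Proof.
rewrite integral_sum//; last first.
  by move=> k; apply: integrableZl => //; exact: (finS _ _).2.
rewrite pair_big/= -sumEFin; apply: eq_bigr => k _.
rewrite integralZl//; last exact: (finS _ _).2.
rewrite EFinM; congr (_ * _)%E; rewrite mxE fineK//.
by apply: integrable_fin_num => //; exact: (finS _ _).2.
Qed.

Let ae_Phi c : {ae mu, forall tau : R, 0 < tau < 1 ->
  P.-integrable setT (fun w => (\sum_i \sum_j c i j * opg X Q tau w i j)%:E) /\
  ('E_P[fun w => (\sum_i \sum_j c i j * opg X Q tau w i j)%R] = Phi c tau)%E}.
Proof.
have : {ae mu, forall (tau : R) (k : 'I_p * 'I_p), 0 < tau < 1 ->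
    P.-integrable setT (fun w => (opg X Q tau w k.1 k.2)%:E)}.
  by apply: (@filter_forall _ _ _ _ aemu) => k; exact: (finS _ _).1.
apply: (@filterS _ _ aemu) => tau Hk t01.
have E w : (\sum_i \sum_j c i j * opg X Q tau w i j)%:E =
    (\sum_(k : 'I_p * 'I_p) (c k.1 k.2)%:E * (opg X Q tau w k.1 k.2)%:E)%E.
  by rewrite pair_big/= -sumEFin; apply: eq_bigr => k _; rewrite EFinM.
split.
  under eq_fun do rewrite E.
  by apply: integrable_sum => // k _; apply: integrableZl => //; exact: Hk.
rewrite unlock; under eq_integral do rewrite E.
rewrite integral_sum//; last first.
  by move=> k; apply: integrableZl => //; exact: Hk.
apply: eq_bigr => k _; rewrite integralZl//; last exact: Hk.
by rewrite unlock.
Qed.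

Lemma copg_ker_dgrad (v : 'cV[R]_p) : S *m v = 0 ->
  {ae mu, forall tau : R, 0 < tau < 1 -> {ae P, forall w, dgrad (Q tau) v (X w) = 0}}.
Proof.
move=> Sv; pose c i j := v i 0 * v j 0.
have cE tau w : \sum_i \sum_j c i j * opg X Q tau w i j =
    dgrad (Q tau) v (X w) ^+ 2.
  rewrite expr2 /dgrad mulr_suml; apply: eq_bigr => i _.
  rewrite mulr_sumr; apply: eq_bigr => j _.
  by rewrite /opg !mxE big_ord1 !mxE /c; ring.
have int0 : (\int[mu]_(tau in I01) Phi c tau = 0)%E.
  rewrite int_Phi; congr EFin.
  transitivity (\sum_i v i 0 * (S *m v) i 0).
    apply: eq_bigr => i _; rewrite mxE mulr_sumr; apply: eq_bigr => j _.
    by rewrite /c; ring.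
  by rewrite Sv big1// => i _; rewrite mxE mulr0.
have mPhi : measurable_fun I01 (Phi c) := measurable_int _ (iPhi c).
have Phi_ge0 : {ae mu, forall tau, I01 tau -> (0 <= Phi c tau)%E}.
  apply: (@filterS _ _ aemu) (ae_Phi c) => tau H; rewrite /I01/= in_itv/= => /H[_ <-].
  rewrite unlock; apply: integral_ge0 => w _.
  by rewrite cE lee_fin sqr_ge0.
have : (\int[mu]_(tau in I01) `|Phi c tau| = 0)%E.
  rewrite -int0; apply: ae_eq_integral => //.
    by apply: measurableT_comp.
  by apply: (@filterS _ _ aemu) Phi_ge0 => tau H /H; move/gee0_abs ->.
move/(ae_eq_integral_abs _ mI01 mPhi) => Phi0.
apply: (@filterS2 _ _ aemu) (ae_Phi c) Phi0 => tau H1 H2 t01.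
have [iS] := H1 t01.
have -> : Phi c tau = 0%E by apply: H2; rewrite /I01/= in_itv.
under eq_fun do rewrite cE.
rewrite unlock => E0.
have mg : measurable_fun setT (fun w => (dgrad (Q tau) v (X w) ^+ 2)%:E).
  by under eq_fun do rewrite -cE; exact: measurable_int iS.
have : (\int[P]_w `|(dgrad (Q tau) v (X w) ^+ 2)%:E| = 0)%E.
  rewrite -[RHS]E0; apply: eq_integral => w _.
  by rewrite gee0_abs// lee_fin sqr_ge0.
move/(ae_eq_integral_abs _ measurableT mg).
apply: filterS => w /(_ Logic.I)/= [] /eqP.
by rewrite sqrf_eq0 => /eqP.
Qed.

Lemma dgrad_copg_ker (v : 'cV[R]_p) :
  {ae mu, forall tau : R, 0 < tau < 1 -> {ae P, forall w, dgrad (Q tau) v (X w) = 0}} ->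
  S *m v = 0.
Proof.
move=> g0; apply/matrixP => i0 j0; rewrite ord1 [RHS]mxE {j0}.
pose c i j : R := if i == i0 then v j 0 else 0.
have cE (M : 'M[R]_p) : \sum_i \sum_j c i j * M i j = (M *m v) i0 0.
  rewrite (bigD1 i0)//= [X in _ + X]big1 ?addr0.
    by rewrite mxE; apply: eq_bigr => j _; rewrite /c eqxx mulrC.
  move=> i /negPf ii0; rewrite big1// => j _.
  by rewrite /c ii0 mul0r.
apply: EFin_inj; rewrite -cE -int_Phi.
have mPhi : measurable_fun I01 (Phi c) := measurable_int _ (iPhi c).
transitivity (\int[mu]_(tau in I01) cst (0%E : \bar R) tau)%E; last first.
  by rewrite integral0.
apply: ae_eq_integral => //.
apply: (@filterS2 _ _ aemu) (ae_Phi c) g0 => tau H1 H2; rewrite /I01/= in_itv/= => t01.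
have [iS <-] := H1 t01; rewrite unlock.
transitivity (\int[P]_w cst (0%E : \bar R) w)%E; last by rewrite integral0.
apply: ae_eq_integral => //; first exact: measurable_int iS.
apply: filterS (H2 t01) => w gw _; rewrite cE; congr EFin.
(* The outer product applied to [v] is the gradient times [dgrad (Q tau) v], so this entry vanishes
   with the second factor. *)
transitivity (partial i0 (Q tau) (X w) * dgrad (Q tau) v (X w)); last first.
  by rewrite gw mulr0.
rewrite mxE /dgrad mulr_sumr.
apply: eq_bigr => j _; rewrite /opg mxE big_ord1 !mxE /=; ring.
Qed.

End copg_kernel.

(** * Column spaces *)

(** The columns of the cokernel of [N^T] lie in the kernel of [N^T], so [M^T] kills them as well.
    Hence [M^T] factors as [C *m N^T], and transposing writes the columns of [M] in terms of those
    of [N]. *)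
Lemma ker_trmx_colspan (R : realType) p r s (M : 'M[R]_(p, r)) (N : 'M[R]_(p, s)) :
  (forall v : 'cV[R]_p, N^T *m v = 0 -> M^T *m v = 0) ->
  colspan M `<=` colspan N.
Proof.
move=> NM.
have /submxP[C MC] : (M^T <= N^T)%MS.
  rewrite submxE; apply/eqP/matrixP => i j; rewrite [RHS]mxE.
  have : M^T *m col j (cokermx N^T) = 0.
    by apply: NM; rewrite colE mulmxA mulmx_coker mul0mx.
  by rewrite colE mulmxA -colE => /matrixP/(_ i 0); rewrite !mxE.
move=> _ [a _ <-]; exists (C^T *m a) => //.
by rewrite mulmxA; congr (_ *m _); rewrite -[RHS]trmxK MC trmx_mul trmxK.
Qed.

Lemma colspan_ker_trmx (R : realType) p r s (M : 'M[R]_(p, r)) (N : 'M[R]_(p, s))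
    (v : 'cV[R]_p) :
  colspan M `<=` colspan N -> N^T *m v = 0 -> M^T *m v = 0.
Proof.
move=> MN Nv; apply/matrixP => i j; rewrite ord1 [RHS]mxE.
have [a _ aE] : colspan N (col i M).
  by apply: MN; exists (delta_mx i 0) => //; rewrite -colE.
transitivity (((col i M)^T *m v) 0 0); last first.
  by rewrite -aE trmx_mul -mulmxA Nv mulmx0 mxE.
by rewrite !mxE; apply: eq_bigr => k _; rewrite !mxE.
Qed.

Lemma gram_cV_gt0 (R : realType) p (w : 'cV[R]_p) : w != 0 ->
  exists2 s : R, 0 < s & w^T *m w = s%:M.
Proof.
move=> w0; exists ((w^T *m w) 0 0); last exact: mx11_scalar.
rewrite lt_def; apply/andP; split; last first.
  by rewrite mxE; apply: sumr_ge0 => i _; rewrite mxE -expr2 sqr_ge0.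
apply: contraNneq w0; rewrite mxE => /psumr_eq0P ww0.
apply/eqP/matrixP => i j; rewrite ord1 [RHS]mxE.
apply/eqP; rewrite -sqrf_eq0 expr2; apply/eqP.
rewrite -[RHS](ww0 _ i)//; first by rewrite mxE.
by move=> k _; rewrite mxE -expr2 sqr_ge0.
Qed.

(** The span is recorded as the kernel of the transpose, because adjoining a column just adds one
    equation to that kernel. *)
Lemma gram_schmidt (R : realType) p m (M : 'M[R]_(p, m)) :
  exists r (B : 'M[R]_(p, r)),
    B^T *m B = 1%:M /\ forall v : 'cV[R]_p, B^T *m v = 0 <-> M^T *m v = 0.
Proof.
elim: m M => [|m IH] M.
  by exists 0, 0; split=> [|v]; [apply/matrixP; case|rewrite !flatmx0].
move: M; rewrite -[m.+1]/(1 + m)%N => M; rewrite -(hsubmxK M).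
set c := lsubmx M; have [r [B [BB BM]]] := IH (rsubmx M).
have ME (v : 'cV[R]_p) :
    (row_mx c (rsubmx M))^T *m v = 0 <-> c^T *m v = 0 /\ B^T *m v = 0.
  rewrite tr_row_mx mul_col_mx; split.
    by move/eqP; rewrite col_mx_eq0 => /andP[/eqP ? /eqP ?]; split => //; exact/BM.
  by move=> [-> /BM ->]; rewrite col_mx0.
(* The residual of the new column. If it is zero the old basis suffices; otherwise it is normalised
   and appended. *)
pose w := c - B *m (B^T *m c).
have wv (v : 'cV[R]_p) : B^T *m v = 0 -> w^T *m v = c^T *m v.
  move=> Bv; rewrite /w linearB/= mulmxBl !trmx_mul trmxK -!mulmxA Bv.
  by rewrite !mulmx0 subr0.
have Bw : B^T *m w = 0 by rewrite /w mulmxBr (mulmxA B^T) BB mul1mx subrr.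
have [w0|w_neq0] := eqVneq w 0.
  exists r, B; split => // v; rewrite ME; split => [Bv|[]//].
  by rewrite -wv// w0 trmx0 mul0mx.
have [s s0 ws] := gram_cV_gt0 w_neq0.
have sq0 : 0 < Num.sqrt s by rewrite sqrtr_gt0.
pose b := (Num.sqrt s)^-1 *: w.
have bv k (v : 'M[R]_(p, k)) : b^T *m v = (Num.sqrt s)^-1 *: (w^T *m v).
  by rewrite /b linearZ/= -scalemxAl.
exists (r + 1)%N, (row_mx B b); split=> [|v].
  have Bb : B^T *m b = 0 by rewrite /b -scalemxAr Bw scaler0.
  have bB : b^T *m B = 0 by rewrite -[LHS]trmxK trmx_mul trmxK Bb trmx0.
  have bb : b^T *m b = 1%:M.
    rewrite bv /b -scalemxAr ws !scale_scalar_mx mulrA -invfM -expr2.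
    by rewrite sqr_sqrtr ?(ltW s0)// mulVf// gt_eqF.
  by rewrite tr_row_mx mul_col_row BB Bb bB bb scalar_mx_block.
rewrite ME tr_row_mx mul_col_mx bv; split.
  move/eqP; rewrite col_mx_eq0 scaler_eq0 invr_eq0 gt_eqF//=.
  by move=> /andP[/eqP Bv /eqP w0]; rewrite -wv.
by move=> [cv Bv]; rewrite Bv wv// cv scaler0 col_mx0.
Qed.

Lemma orthonormal_basis_colspan (R : realType) p m (M : 'M[R]_(p, m)) :
  exists r (B : 'M[R]_(p, r)),
    [/\ (r <= p)%N, B^T *m B = 1%:M & colspan B = colspan M].
Proof.
have [r [B [BB BM]]] := gram_schmidt M; exists r, B; split => //.
  rewrite -(mxrank1 R r) -BB (leq_trans (mxrankM_maxl _ _))//.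
  exact: rank_leq_col.
by apply/seteqP; split; apply: ker_trmx_colspan => v /BM.
Qed.

(** * Quantiles and the central subspace *)

Lemma mderiv0 (R : realType) n (u : 'cV[R]_n -> R) : mderiv [ffun=> 0%N] u = u.
Proof.
rewrite /mderiv (_ : flatten _ = [::])//; elim: (enum _) => //= i s ->.
by rewrite ffunE.
Qed.

Lemma holder_continuous (R : realType) (V : normedModType R) (C g : R)
    (D : set V) (u : V -> R) :
  0 < C -> 0 < g -> open D ->
  (forall x y, D x -> D y -> `|u x - u y| <= C * `|x - y| `^ g) ->
  {in D, continuous u}.
Proof.
move=> C0 g0 oD hm x; rewrite inE => Dx.
have /nbhs_ballP[e' /= e'0 e'D] : nbhs x D by exact: open_nbhs_nbhs.
apply/cvgrPdist_lt => e e0.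
pose h := (e / C) `^ g^-1.
have h0 : 0 < h by rewrite powR_gt0// divr_gt0.
apply/nbhs_ballP; exists (Num.min e' h); first by rewrite /= lt_min e'0.
move=> y; rewrite -ball_normE/= lt_min => /andP[ye' yh].
have Dy : D y by apply: e'D; rewrite -ball_normE.
apply: (le_lt_trans (hm _ _ Dx Dy)); rewrite mulrC -ltr_pdivlMr//.
rewrite -[ltRHS]powRr1 ?divr_ge0 ?ltW// -(mulVf (lt0r_neq0 g0)) powRrM.
by apply: gt0_ltr_powR => //; rewrite nnegrE ?normr_ge0// ltW.
Qed.

(** For [l = 0] continuity comes from the Holder bound, for [l > 0] from differentiability, in both
    cases at the zero multi-index. *)
Lemma holder_with_continuous (R : realType) n (s C : R) (D : set 'cV[R]_n)
    (u : 'cV[R]_n -> R) :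
  0 < C -> open D -> holder_with s C D u -> {in D, continuous u}.
Proof.
move=> C0 oD [l [g [/andP[g0 g1] _ dm hm]]].
case: l => [|l] in dm hm *; last first.
  move=> x; rewrite inE => Dx; have := dm [ffun=> 0%N] x; rewrite mderiv0 => dx.
  apply: differentiable_continuous; apply: dx => //.
  by rewrite /mindex_order big1// => i _; rewrite ffunE.
apply: (@holder_continuous _ _ C g) => // x1 x2 D1 D2.
have := hm [ffun=> 0%N] x1 x2; rewrite mderiv0; apply => //.
by rewrite /mindex_order big1// => i _; rewrite ffunE.
Qed.

Section quantiles.
Variable R : realType.
Implicit Types (F G : cumulativeBounded (0 : R) (1 : R)) (tau : R).

Lemma cdf_bounds F y : 0 <= F y <= 1.
Proof.
apply/andP; split.
  apply: (cvgr_to_le (cumulativeNy F)); exists y; split; first exact: num_real.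
  by move=> z zy; apply: cumulative_is_nondecreasing; exact: ltW.
apply: (cvgr_to_ge (cumulativey F)); exists y; split; first exact: num_real.
by move=> z zy; apply: cumulative_is_nondecreasing; exact: ltW.
Qed.

(** The Galois connection between a distribution function and its quantiles, through which the later
    arguments compare the two. *)
Lemma quantile_le F tau y : 0 < tau < 1 -> (quantile F tau <= y) = (tau <= F y).
Proof.
move=> t01; have [Fq qF] := quantile_min F t01; apply/idP/idP; last exact: qF.
move=> qy; apply: (le_trans Fq); exact: cumulative_is_nondecreasing.
Qed.

(** A rational strictly between two different quantiles would separate the distribution functions.
    Restricting to rationals lets countably many almost sure identities suffice. *)
Lemma eq_rat_quantile F G tau : 0 < tau < 1 ->
  (forall s : rat, F (ratr s) = G (ratr s)) -> quantile F tau = quantile G tau.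
Proof.
move=> t01; wlog suff : F G / (forall s : rat, F (ratr s) = G (ratr s)) ->
    quantile F tau <= quantile G tau.
  move=> H FG; apply/le_anti/andP; split; exact: H.
move=> FG; rewrite leNgt; apply/negP => GF.
have [s] := rat_in_itvoo GF; rewrite in_itv/= => /andP[Gs sF].
by move: (ltW Gs); rewrite quantile_le// -FG -quantile_le// leNgt sF.
Qed.

(** If [F y < G y], the levels between them form an interval of positive length, so the quantiles
    agree at one of them; yet there the quantile of [G] is at most [y] and that of [F] exceeds
    [y]. *)
Lemma eq_quantile_cdf F G y :
  {ae @lebesgue_measure R, forall tau, 0 < tau < 1 -> quantile F tau = quantile G tau} ->
  F y = G y.
Proof.
wlog suff : F G /
    {ae @lebesgue_measure R, forall tau, 0 < tau < 1 -> quantile F tau = quantile G tau} ->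
    G y <= F y.
  move=> H FG; apply/le_anti/andP; split; apply: H => //.
  apply: (@filterS _ _ (ae_filter_ringOfSetsType _)) FG => tau FG t01.
  by rewrite FG.
move=> [N [mN N0 HN]]; rewrite leNgt; apply/negP => FG.
have [tau] : exists2 tau, F y < tau < G y & ~ N tau.
  apply: contrapT => /forall2NP H.
  have : (lebesgue_measure (`]F y, G y[ : set (measurableTypeR R)) <= 0)%E.
    rewrite -N0; apply: le_measure; [rewrite inE; exact: measurable_itv|by rewrite inE|].
    by move=> tau; rewrite /= in_itv/= => tFG; case: (H tau) => // /contrapT.
  rewrite lebesgue_measure_itv/= lte_fin FG -EFinB lee_fin.
  by rewrite leNgt subr_gt0 FG.
move=> /andP[Ft tG] /(contra_not (HN tau))/contrapT qE.
have t01 : 0 < tau < 1.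
  have /andP[F0 _] := cdf_bounds F y; have /andP[_ G1] := cdf_bounds G y.
  by rewrite (le_lt_trans F0 Ft) (lt_le_trans tG G1).
by have := ltW tG; rewrite -quantile_le// -qE// quantile_le// leNgt Ft.
Qed.

End quantiles.

Lemma open_setI_preimage (R : realType) (V : topologicalType) (D : set V)
    (u : V -> R) (O : set R) :
  open D -> {in D, continuous u} -> open O -> open (D `&` u @^-1` O).
Proof.
move=> oD cu oO; rewrite openE => x [Dx ux]; apply: filterI.
  exact: open_nbhs_nbhs.
by apply: cu; [rewrite inE|exact: open_nbhs_nbhs].
Qed.

Lemma shift_continuous_sub (R : realType) (V : normedModType R) (D : set V)
    (u : V -> R) (a : V) : open D -> {in D, continuous u} ->
  open [set x | D x /\ D (x + a)] /\
  {in [set x | D x /\ D (x + a)], continuous (fun x => u (x + a) - u x)}.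
Proof.
move=> oD cu.
have ca : continuous (fun x : V => x + a).
  by move=> x; apply: cvgD; [exact: cvg_id|exact: cvg_cst].
split.
  rewrite openE => x [Dx Dxa]; apply: filterI; first exact: open_nbhs_nbhs.
  by apply: ca; exact: open_nbhs_nbhs.
move=> x; rewrite inE => -[Dx Dxa]; apply: cvgB; last by apply: cu; rewrite inE.
apply: (@continuous_comp _ _ _ (fun x : V => x + a) u); first exact: ca.
by apply: cu; rewrite inE.
Qed.

Lemma open_image_trmx (R : realType) p r (B : 'M[R]_(p, r)) (U : set 'cV[R]_p) :
  B^T *m B = 1%:M -> open U -> open [set B^T *m x | x in U].
Proof.
move=> BB oU; rewrite openE => _ [u Uu <-].
have /nbhs_ballP[e /= e0 eU] : nbhs u U by exact: open_nbhs_nbhs.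
(* A crude bound on the operator norm of [B], made positive by the 1. It controls the preimage
   [u + B *m (z - B^T *m u)] of [z], which is close to [u] when [z] is close to [B^T *m u]. *)
pose K := 1 + \sum_i \sum_j `|B i j|.
have K0 : 0 < K.
  by rewrite ltr_wpDr// sumr_ge0// => i _; rewrite sumr_ge0.
have BK (w : 'cV[R]_r) : `|B *m w| <= K * `|w|.
  rewrite mulrDl mul1r ler_wpDl//; apply: mx_norm_le.
    by rewrite mulr_ge0// sumr_ge0// => i _; rewrite sumr_ge0.
  move=> i j; rewrite ord1 mxE mulr_suml (bigD1 i)//= mulr_suml.
  apply: (le_trans (ler_norm_sum _ _ _)); rewrite ler_wpDr//.
    by rewrite sumr_ge0// => k _; rewrite mulr_ge0// sumr_ge0.
  apply: ler_sum => k _; rewrite normrM ler_wpM2l//; exact: coord_le_norm.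
apply/nbhs_ballP; exists (e / K); first by rewrite /= divr_gt0.
move=> z; rewrite -ball_normE/= => uz.
exists (u + B *m (z - B^T *m u)); last first.
  by rewrite mulmxDr mulmxA BB mul1mx addrC subrK.
apply: eU; rewrite -ball_normE/= opprD addNKr normrN.
by apply: (le_lt_trans (BK _)); rewrite mulrC -ltr_pdivlMr// distrC.
Qed.

Lemma measurable_mulmx_cV (R : realType) p r (A : 'M[R]_(r, p)) :
  measurable_fun setT (fun x : 'cV[R]_p => A *m x).
Proof.
apply: measurable_fun_matrix => i j; under eq_fun do rewrite mxE.
apply: measurable_sum => k; apply: measurable_funM => //.
exact: measurable_matrix_entry.
Qed.

Lemma ae_translate_cV (R : realType) n (a : 'cV[R]_n) (H : 'cV[R]_n -> Prop) :
  {ae lebesgue_cV R n, forall x, H x} -> {ae lebesgue_cV R n, forall x, H (a + x)}.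
Proof.
move=> [N [mN N0 HN]]; exists ((fun x => a + x) @^-1` N); split.
- rewrite -[X in measurable X]setTI.
  have ma : measurable_fun setT (fun x : 'cV[R]_n => a + x).
    apply: measurable_fun_matrix => i j; under eq_fun do rewrite mxE.
    by apply: measurable_funD => //; exact: measurable_matrix_entry.
  exact: ma.
- by rewrite /= lebesgue_cV_translate.
- by move=> x /= Hx; exact: HN.
Qed.

Lemma ae_forall_rat d (T : measurableType d) (R : realType)
    (mu : {measure set T -> \bar R}) (H : rat -> T -> Prop) :
  (forall s, {ae mu, forall x, H s x}) -> {ae mu, forall x, forall s, H s x}.
Proof.
move=> aeH.
pose H' k x := if unpickle k is Some s then H s x else True.
have /ae_foralln : forall k, {ae mu, forall x, H' k x}.
  move=> k; rewrite /H'; case: unpickle => [s|]; first exact: aeH.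
  exact: aeW.
by apply: filterS => x H'x s; have := H'x (pickle s); rewrite /H' pickleK.
Qed.

Lemma trmx_copg d (T : measurableType d) (R : realType) (P : probability T R) p
    (X : T -> 'cV[R]_p) Q : (copg P X Q)^T = copg P X Q.
Proof.
apply/matrixP => i j; rewrite !mxE; congr fine; apply: eq_integral => tau _.
by congr expectation; apply/funext => w; rewrite /opg !mxE !big_ord1 !mxE mulrC.
Qed.

(** * The two inclusions between the column spaces *)

Section central_subspace_copg.
Context {d} {T : measurableType d} {R : realType} (P : probability T R).
Variables (p : nat) (Y : {RV P >-> R}) (X : {RV P >-> 'cV[R]_p}).
Variable F : 'cV[R]_p -> cumulativeBounded (0 : R) (1 : R).
Variable fX : 'cV[R]_p -> R.
Local Notation D := [set x : 'cV[R]_p | 0 < fX x].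
Local Notation Q := (cond_quantile F).
Local Notation S := (copg P X Q).
Local Notation leb := (@lebesgue_measure R).
Hypothesis F_cdf : is_cond_cdf Y X F.
Hypothesis fX_density : is_density X fX.
Hypothesis oD : open D.
Hypothesis convexD : convex_set D.
Hypothesis cfX : {in D, continuous fX}.
Hypothesis cQ : forall tau : R, 0 < tau < 1 -> {in D, continuous (Q tau)}.
Hypothesis dQ : forall (tau : R) x (i : 'I_p), 0 < tau < 1 -> D x ->
  derivable (Q tau) x (delta_mx i 0).
Hypothesis finS : copg_finite P X Q.

Let aeleb : Filter (nbhs (almost_everywhere leb)).
Proof. exact: ae_filter_ringOfSetsType. Qed.

(** The diagonal entries of [opg] are the squares of the partial derivatives, so for almost every
    level these are square integrable under the law of [X]. *)
Let partial_integrable_near : {ae leb, forall tau : R, 0 < tau < 1 ->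
  forall x, D x -> exists2 r, 0 < r &
    forall i, (lebesgue_cV R p).-integrable (ball x r)
      (fun y => (partial i (Q tau) y)%:E)}.
Proof.
have : {ae leb, forall (tau : R) (i : 'I_p), 0 < tau < 1 ->
    P.-integrable setT (fun w => (opg X Q tau w i i)%:E)}.
  by apply: (@filter_forall _ _ _ _ aeleb) => i; exact: (finS i i).1.
apply: (@filterS _ _ aeleb) => tau H t01 x Dx.
have : forall i, exists r, 0 < r /\ (lebesgue_cV R p).-integrable (ball x r)
    (fun y => (partial i (Q tau) y)%:E).
  move=> i; have mi : measurable_fun D (partial i (Q tau)).
    by apply: measurable_partial => //; [exact: cQ|move=> z; exact: dQ].
  have [|r r0 ir] := sqr_integrable_near fX_density oD cfX Dx mi.
    have := H i t01; congr (_.-integrable _ _); apply/funext => w.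
    by rewrite /opg !mxE big_ord1 !mxE.
  by exists r; split.
(* One radius for all coordinates; the default 1 keeps the minimum positive when there are none. *)
move/choice => [r Hr]; pose m := \big[Num.min/1]_i r i.
exists m; first by apply: lt_bigmin => // i _; exact: (Hr i).1.
move=> i; apply: (integrableS _ _ _ (Hr i).2); [exact: measurable_ball_cV..|].
by apply: le_ball; exact: bigmin_le.
Qed.

(** The exceptional set consists of levels only, so the identity holds at every [x] and [y]. *)
Let copg_ker_cdf (v : 'cV[R]_p) x y :
  S *m v = 0 -> D x -> D (x + v) -> F (x + v) y = F x y.
Proof.
move=> Sv Dx Dxv; apply: eq_quantile_cdf.
apply: (@filterS2 _ _ aeleb) (copg_ker_dgrad finS Sv) partial_integrable_near.
move=> tau gv iQ t01.
have mD : measurable D by exact: measurable_density_support fX_density.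
apply: (@dgrad_eq0_constant _ _ D (Q tau) v) => //.
- exact: cQ.
- by move=> z i; exact: dQ.
- exact: iQ.
apply: (ae_density_lebesgue fX_density (H := fun x => dgrad (Q tau) v x = 0)) (gv t01).
have mg : measurable_fun D (dgrad (Q tau) v).
  apply: measurable_sum => i; apply: measurable_funM => //.
  by apply: measurable_partial => //; [exact: cQ|move=> z; exact: dQ].
exact: (mg mD (~` [set 0]) (measurableC (measurable_set1 0))).
Qed.

Let quantile_constant_copg_ker (v : 'cV[R]_p) :
  (forall (tau : R) x (t : R), 0 < tau < 1 -> D x -> D (x + t *: v) ->
     Q tau (x + t *: v) = Q tau x) ->
  S *m v = 0.
Proof.
move=> Qv; apply: (dgrad_copg_ker finS).
apply: (@filterS _ _ aeleb) partial_integrable_near => tau iQ t01.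
apply: (ae_lebesgue_density fX_density (H := fun x => dgrad (Q tau) v x = 0)).
apply: constant_dgrad_eq0 => //.
- exact: cQ.
- by move=> z i; exact: dQ.
- exact: iQ.
- by move=> x t; exact: Qv.
Qed.

(** The identity between [F] and [G] is used at rational arguments, one measurable failure set at a
    time. Translating null sets makes it hold at both [z] and [z + v] for almost every [z], where
    the two quantiles then agree; continuity of [Q tau] reaches every point. *)
Let DRS_quantile_constant r (B : 'M[R]_(p, r))
    (G : 'cV[R]_r -> cumulativeBounded (0 : R) (1 : R)) (v : 'cV[R]_p) (tau : R) x :
  (forall y, measurable_fun setT (fun z => G z y)) ->
  {ae P, forall w, forall y, F (X w) y = G (B^T *m X w) y} ->
  B^T *m v = 0 -> 0 < tau < 1 -> D x -> D (x + v) -> Q tau (x + v) = Q tau x.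
Proof.
move=> mG FG Bv t01 Dx Dxv.
have mD : measurable D by exact: measurable_density_support fX_density.
have FGD : {ae lebesgue_cV R p, forall x,
    forall s : rat, D x -> F x (ratr s) = G (B^T *m x) (ratr s)}.
  apply: ae_forall_rat => s.
  apply: (ae_density_lebesgue fX_density
    (H := fun x => F x (ratr s) = G (B^T *m x) (ratr s))); last first.
    by apply: filterS FG => w; exact.
  have mFG : measurable_fun setT (fun x => F x (ratr s) - G (B^T *m x) (ratr s)).
    apply: measurable_funB; first exact: F_cdf.1.
    by apply: (measurableT_comp (mG _)); exact: measurable_mulmx_cV.
  apply: measurableI => //.
  have := mFG measurableT _ (measurableC (measurable_set1 0)).
  rewrite setTI; congr (measurable _); apply/seteqP; split => z /=.
    by apply: contra_not => ->; rewrite subrr.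
  by apply: contra_not => /eqP; rewrite subr_eq0 => /eqP.
have FGDv := ae_translate_cV v FGD.
have [oO cO] := shift_continuous_sub v oD (cQ t01).
have O0 : {ae lebesgue_cV R p, forall x, D x /\ D (x + v) ->
    Q tau (x + v) - Q tau x = 0}.
  apply: filterS2 FGD FGDv => z Hz Hzv [Dz Dzv].
  apply/eqP; rewrite subr_eq0; apply/eqP; apply: eq_rat_quantile => // s.
  by rewrite Hz// addrC Hzv addrC// mulmxDr Bv addr0.
by apply/eqP; rewrite -subr_eq0; apply/eqP; exact: (ae_continuous_eq0 oO cO O0).
Qed.

(** [F x y < tau] means [Q tau x > y], an open condition on [x] in [D] by continuity of [Q tau]; the
    set is a union of such sets over levels [tau <= c]. *)
Let open_cdf_lt y c : open [set x | D x /\ F x y < c].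
Proof.
have [c1|c1] := ltP 1 c.
  rewrite (_ : [set _ | _] = D)//; apply/seteqP; split => x /=; first by case.
  move=> Dx; split=> //; apply: le_lt_trans c1.
  by have /andP[] := cdf_bounds (F x) y.
rewrite (_ : [set _ | _] = \bigcup_(tau in [set tau : R | 0 < tau < 1 /\ tau <= c])
    (D `&` Q tau @^-1` `]y, +oo[)).
  apply: bigcup_open => tau [t01 _]; apply: open_setI_preimage => //.
  exact: cQ.
apply/seteqP; split=> x /=.
  move=> [Dx Fc]; have /andP[F0 _] := cdf_bounds (F x) y.
  (* The midpoint lies strictly between 0 and 1 because [0 <= F x y < c <= 1]. *)
  exists ((F x y + c) / 2) => /=; first by split; lra.
  split => //; rewrite in_itv/= andbT ltNge quantile_le; last by lra.
  by rewrite -ltNge; lra.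
move=> [tau [t01 tc] [Dx]]; rewrite /= in_itv/= andbT ltNge quantile_le// -ltNge.
by move=> Ft; split => //; exact: lt_le_trans tc.
Qed.

(* G z is F at some preimage of z in D under B^T; it is measurable because B^T is
   an open map and [F < c] is open in D. *)
Let copg_DRS : is_DRS Y X F (colspan S).
Proof.
have [r [B [rp BB BS]]] := orthonormal_basis_colspan S.
(* The difference [x - x'] is in the kernel of [B^T], which is the kernel of the symmetric matrix
   [S]. *)
have Bker x x' y : D x -> D x' -> B^T *m x = B^T *m x' -> F x y = F x' y.
  move=> Dx Dx' Bx; have -> : x = x' + (x - x') by rewrite addrC subrK.
  apply: copg_ker_cdf => //; last by rewrite addrC subrK.
  rewrite -trmx_copg; apply: (@colspan_ker_trmx _ _ _ _ _ B).
    by rewrite BS.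
  by rewrite mulmxBr Bx subrr.
have [x0 Dx0] := density_support_nonempty fX_density.
pose g (z : 'cV[R]_r) := xget x0 [set x | D x /\ B^T *m x = z].
have Dg z : D (g z) by rewrite /g; case: xgetP => // x _ [].
have Bg x : D x -> B^T *m g (B^T *m x) = B^T *m x.
  by rewrite /g; case: xgetP => [z _ []//|/(_ x) H Dx]; case: H.
have FG x y : D x -> F (g (B^T *m x)) y = F x y.
  by move=> Dx; apply: Bker => //; exact: Bg.
have FGae : {ae P, forall w, forall y, F (X w) y = F (g (B^T *m X w)) y}.
  apply: (ae_lebesgue_density fX_density
    (H := fun x => forall y, F x y = F (g (B^T *m x)) y)).
  by apply: aeW => x Dx y; rewrite (FG x y).
have mG y : measurable_fun setT (fun z => F (g z) y).
  apply: (measurability _ (RGenInftyO.measurableE R)).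
  move=> _ [_ [c ->] <-]; rewrite setTI.
  pose V (A : set 'cV[R]_p) := [set B^T *m x | x in A].
  have mV A : open A -> measurable (V A).
    by move=> oA; apply: open_measurable_cV; exact: open_image_trmx.
  (* Outside the image of [D], [g] takes the default value [x0], so that part of the preimage is all
     of the complement or nothing. *)
  rewrite (_ : _ @^-1` _ = V [set x | D x /\ F x y < c] `|`
      (~` V D `&` [set _ | F x0 y < c])); last first.
    apply/seteqP; split => z /=; rewrite in_itv/=.
      move=> gc; have [[x Dx xz]|VDz] := pselect (V D z).
        by left; exists x => //; split => //; rewrite -(FG x y)// xz.
      right; split => //; move: gc; rewrite /g xgetPN// => x [Dx xz].
      by apply: VDz; exists x.
    move=> [[x [Dx Fx] <-]|[VDz F0]]; first by rewrite (FG x y).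
    by rewrite /g xgetPN// => x [Dx xz]; apply: VDz; exists x.
  apply: measurableU; first by apply: mV; exact: (@open_cdf_lt y c).
  apply: measurableI; first by apply: measurableC; apply: mV; exact: oD.
  by have [F0|F0] := pselect (F x0 y < c);
    [rewrite (_ : [set _ | _] = setT)|rewrite (_ : [set _ | _] = set0)] => //;
    apply/seteqP; split.
exists r, B, (F \o g); split => //; split => //=.
move=> A y mA.
have mBX : measurable_fun setT (fun x : 'cV[R]_p => B^T *m x) := measurable_mulmx_cV _.
have mA' : measurable ((fun x : 'cV[R]_p => B^T *m x) @^-1` A).
  by rewrite -[X in measurable X]setTI; exact: mBX.
rewrite [LHS](F_cdf.2 _ y mA').
apply: ae_eq_integral.
- by rewrite -[X in measurable X]setTI; exact: measurable_funPT.
- apply/measurable_EFinP; apply: measurable_funTS.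
  by apply: (measurableT_comp (F_cdf.1 y)); exact: measurable_funPT.
- apply/measurable_EFinP; apply: measurable_funTS.
  apply: (measurableT_comp (mG y)); apply: (measurableT_comp mBX).
  exact: measurable_funPT.
- by apply: filterS FGae => w H _; rewrite H.
Qed.

(** That [V] is itself a dimension reduction subspace bounds [colspan S] from above; that [V] is the
    intersection of all of them, [colspan S] included, bounds it from below. *)
Lemma copg_central_subspace (V : set 'cV[R]_p) :
  V = central_subspace Y X F -> is_DRS Y X F V -> colspan S = V.
Proof.
move=> VE; case=> r [B [G [_ _ VB [mG _] FG]]].
apply/seteqP; split; last by rewrite VE; apply: bigcap_inf; exact: copg_DRS.
rewrite VB; apply: ker_trmx_colspan => v Bv; rewrite trmx_copg.
apply: quantile_constant_copg_ker => tau x t t01 Dx Dxv.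
apply: (DRS_quantile_constant mG FG) => //.
by rewrite -scalemxAr Bv scaler0.
Qed.

End central_subspace_copg.

Theorem lemma1 (R : realType) (d : measure_display) (T : measurableType d)
    (P : probability T R) (p : nat)
    (Y : {RV P >-> R}) (X : {RV P >-> 'cV[R]_p})
    (F : 'cV[R]_p -> cumulativeBounded (0 : R) (1 : R))
    (fX : 'cV[R]_p -> R) (fYX : R -> 'cV[R]_p -> R)
    (q : nat) (B0 : 'M[R]_(p, q)) :
  let D := [set x : 'cV[R]_p | 0 < fX x] in
  let Q := cond_quantile F in
  let S0 := central_subspace Y X F in
  is_cond_cdf Y X F ->
  is_DRS Y X F S0 ->
  B0^T *m B0 = 1%:M ->
  colspan B0 = S0 ->
  is_density X fX ->
  bounded_set D -> open D -> convex_set D ->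
  (exists2 s1 : R, 0 < s1 & holder_class s1 D fX) ->
  (exists s2 C : R, [/\ 0 < s2, 0 < C &
     forall tau : R, 0 < tau < 1 -> holder_with s2 C D (Q tau)]) ->
  (exists2 k : nat, (0 < k)%N &
     forall tau : R, 0 < tau < 1 -> has_partials_upto k D (Q tau)) ->
  is_cond_density F D fYX ->
  (exists delta b1 b2 s3 : R,
     [/\ [/\ 0 < delta, 0 < b1, 0 < b2 & 0 < s3],
         holder_class s3 [set z : 'cV[R]_(1 + p) | D (dsubmx z)]
           (fun z => fYX (usubmx z 0 0) (dsubmx z)) &
         exists2 c : R, 0 < c &
           forall tau x y, delta <= tau <= 1 - delta -> D x ->
             Q tau x - b1 < y < Q tau x + b2 -> c <= fYX y x]) ->
  copg_finite P X Q ->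
  {ae lebesgue_measure, forall tau : R, 0 < tau < 1 ->
     {ae P, forall w, has_gradient (Q tau) (X w)}} ->
  colspan (copg P X Q) = colspan B0.
Proof.
move=> D Q S0 F_cdf S0_DRS _ B0S0 fX_density _ oD convexD [s1 s1_gt0 [C1 C1_gt0 fXh]].
move=> [s2 [C2 [s2_gt0 C2_gt0 Qh]]] [k k_gt0 Qk] _ _ finS _; rewrite B0S0.
apply: (copg_central_subspace F_cdf fX_density oD convexD _ _ _ finS) => //.
- exact: holder_with_continuous fXh.
- by move=> tau t01; exact: (holder_with_continuous C2_gt0 oD (Qh tau t01)).
(* With no prior differentiation, [[::]], the condition [0 < k] yields the first partial
   derivatives. *)
- by move=> tau x i t01 Dx; exact: (Qk tau t01 [::]).
Qed.
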